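(* Let $K$ be a field and $E$ a finite directed graph with $|E^0_{\mathrm{reg}}|=p$ and $|E^0|=q$. If $n=|E^0|+|E^1|$, then $$\mathbb M_n(L(E))\cong \mathbb M_n(K^{E^0})\amalg_{K^{p+q+1}}\bigl(\mathbb M_2(K)^p\times K^{q-p+1}\bigr)$$ as $K$-algebras, where $\amalg_{K^{p+q+1}}$ is the coproduct in the category of $K^{p+q+1}$-rings. Here $\mathbb M_n(K^{E^0})$ and $\mathbb M_2(K)^p\times K^{q-p+1}$ are viewed as $K^{p+q+1}$-rings via the maps $$(x_1,\dots,x_{p+q+1})\mapsto e_{P_1}x_1+e_{Q_1}x_2+\dots+e_{P_p}x_{2p-1}+e_{Q_p}x_{2p}+e_{p+1}x_{2p+1}+\dots+e_qx_{p+q}+e_0x_{p+q+1}$$ and $$(x_1,\dots,x_{p+q+1})\mapsto(e_{11}x_1+e_{22}x_2,\dots,e_{11}x_{2p-1}+e_{22}x_{2p},x_{2p+1},\dots,x_{p+q},x_{p+q+1}),$$ respectively, where $e_{11},e_{22}$ are standard matrix units in $\mathbb M_2(K)$ and the idempotents $e_{P_i},e_{Q_i},e_i,e_0\in\mathbb M_n(K^{E^0})$ are those defined in the context.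
   Context: A directed graph is $E=(E^0,E^1,r,s)$ with sets $E^0$ (vertices), $E^1$ (edges) and maps $r,s:E^1\to E^0$; it is finite if $E^0,E^1$ are finite. A vertex $v$ is a sink if $s^{-1}(v)=\emptyset$ and regular if $0<|s^{-1}(v)|<\infty$; $E^0_{\mathrm{reg}}$ and $E^0_{\mathrm{sink}}$ are the sets of regular vertices and of sinks. The Leavitt path algebra $L(E)$ is the $K$-algebra presented by generators $v,e,e^*$ ($v\in E^0$, $e\in E^1$) and relations: (i) $uv=\delta_{uv}u$ ($u,v\in E^0$); (ii) $s(e)e=e=er(e)$, $r(e)e^*=e^*=e^*s(e)$ ($e\in E^1$); (iii) $e^*f=\delta_{ef}r(e)$ ($e,f\in E^1$); (iv) $\sum_{e\in s^{-1}(v)}ee^*=v$ ($v\in E^0_{\mathrm{reg}}$). For finite $E$ it is unital with $1=\sum_{v\in E^0}v$. For a ring $R_0$, an $R_0$-ring is a unital ring with a homomorphism from $R_0$; morphisms of $R_0$-rings are ring homomorphisms commuting with the maps from $R_0$. Notation: write $E^0_{\mathrm{reg}}=\{v_1,\dots,v_p\}$, $E^0_{\mathrm{sink}}=\{v_{p+1},\dots,v_q\}$ and $s^{-1}(v_i)=\{f_{i,1},\dots,f_{i,m_i}\}$ for $1\le i\le q$ (so $m_i=0$ if $i>p$). $K^{E^0}$ is the product algebra and $\alpha_v\in K^{E^0}$ is the element whose $v$-th component is $1$ and whose other components are $0$. For $1\le k\le n$ and $v\in E^0$, $\epsilon^v_k\in\mathbb M_n(K^{E^0})$ is the matrix with entry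 $\alpha_v$ at position $(k,k)$ and $0$ elsewhere. Set $\widehat m_i=\sum_{l=1}^{i-1}(m_l+1)$ and $$e_{P_i}=\epsilon^{v_i}_{\widehat m_i+1},\qquad e_{Q_i}=\sum_{j=1}^{m_i}\epsilon^{r(f_{i,j})}_{\widehat m_i+1+j}\qquad(1\le i\le p),$$ $$e_i=\epsilon^{v_i}_{\widehat m_i+1}\quad(p+1\le i\le q),\qquad e_0=1-\sum_{i=1}^p(e_{P_i}+e_{Q_i})-\sum_{i=p+1}^qe_i.$$ ($e_0$ may be $0$.) *)

(* Defs.v *)
From HB Require Import structures.
From mathcomp Require Import all_boot all_order all_algebra.
From mathcomp Require Import boolp.

Set Implicit Arguments.
Unset Strict Implicit.
Unset Printing Implicit Defensive.

Import GRing.Theory.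
Local Open Scope ring_scope.
Local Open Scope quotient_scope.

(* Unital associative K-algebras, given by a ring and a central structure map.
   MathComp's [algType] excludes the zero ring, which does occur here (the
   Leavitt path algebra of the graph without vertices, matrices of size 0). *)
Record kalg (K : comPzRingType) := KAlg {
  kring :> pzRingType;
  kin : {rmorphism K -> kring};
  kin_central : forall (c : K) (x : kring), kin c * x = x * kin c
}.

Arguments kin {K} A : rename.

Record algHom (K : comPzRingType) (A B : kalg K) := AlgHom {
  algHom_fun :> {rmorphism A -> B};
  algHom_kin : forall c : K, algHom_fun (kin A c) = kin B c
}.

Definition alg_isomorphic (K : comPzRingType) (A B : kalg K) : Prop :=
  exists phi : algHom A B, bijective phi.

Section BasicAlgebras.

Variable K : comPzRingType.

Definition self_alg : kalg K :=
  @KAlg K K (idfun : {rmorphism K -> K}) (fun c x => mulrC c x).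

Section Pow.
Variables (X : finType) (A : kalg K).
Definition pow_kin (c : K) : {ffun X -> A} := [ffun => kin A c].
Fact pow_kin_nmod : pow_kin 0 = 0 /\ {morph pow_kin : x y / x + y}.
Proof.
by split=> [|x y]; apply/ffunP=> i; rewrite !ffunE (rmorph0, rmorphD).
Qed.
Fact pow_kin_monoid : pow_kin 1 = 1 /\ {morph pow_kin : x y / x * y}.
Proof.
by split=> [|x y]; apply/ffunP=> i; rewrite !ffunE (rmorph1, rmorphM).
Qed.
HB.instance Definition _ :=
  GRing.isNmodMorphism.Build K {ffun X -> A} pow_kin pow_kin_nmod.
HB.instance Definition _ :=
  GRing.isMonoidMorphism.Build K {ffun X -> A} pow_kin pow_kin_monoid.
Fact pow_kin_central (c : K) (x : {ffun X -> A}) :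
  pow_kin c * x = x * pow_kin c.
Proof. by apply/ffunP=> i; rewrite !ffunE kin_central. Qed.
Definition pow_alg : kalg K := @KAlg K {ffun X -> A} pow_kin pow_kin_central.
End Pow.

Section Prod.
Variables A B : kalg K.
Definition prod_kin (c : K) : A * B := (kin A c, kin B c).
Fact prod_kin_nmod : prod_kin 0 = 0 /\ {morph prod_kin : x y / x + y}.
Proof. by split=> [|x y]; congr (_, _); rewrite (rmorph0, rmorphD). Qed.
Fact prod_kin_monoid : prod_kin 1 = 1 /\ {morph prod_kin : x y / x * y}.
Proof. by split=> [|x y]; congr (_, _); rewrite (rmorph1, rmorphM). Qed.
HB.instance Definition _ :=
  GRing.isNmodMorphism.Build K (A * B)%type prod_kin prod_kin_nmod.
HB.instance Definition _ :=
  GRing.isMonoidMorphism.Build K (A * B)%type prod_kin prod_kin_monoid.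
Fact prod_kin_central (c : K) (x : A * B) : prod_kin c * x = x * prod_kin c.
Proof. by case: x => a b; congr (_, _); apply: kin_central. Qed.
Definition prod_alg : kalg K := @KAlg K (A * B)%type prod_kin prod_kin_central.
End Prod.

Section Mat.
Variables (n : nat) (A : kalg K).
Definition mat_kin (c : K) : 'M[A]_n := (kin A c)%:M.
Fact mat_kin_nmod : mat_kin 0 = 0 /\ {morph mat_kin : x y / x + y}.
Proof.
by split=> [|x y]; rewrite /mat_kin ?rmorph0 ?raddf0 ?rmorphD ?raddfD.
Qed.
Fact mat_kin_monoid : mat_kin 1 = 1 /\ {morph mat_kin : x y / x * y}.
Proof. by split=> [|x y]; rewrite /mat_kin ?rmorph1 ?rmorphM ?rmorph1. Qed.
HB.instance Definition _ :=
  GRing.isNmodMorphism.Build K 'M[A]_n mat_kin mat_kin_nmod.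
HB.instance Definition _ :=
  GRing.isMonoidMorphism.Build K 'M[A]_n mat_kin mat_kin_monoid.
Fact mat_kin_central (c : K) (x : 'M[A]_n) : mat_kin c * x = x * mat_kin c.
Proof.
apply/matrixP=> i j; rewrite [LHS]mxE [RHS]mxE.
rewrite [LHS](bigD1 i) //= [RHS](bigD1 j) //= !mxE !eqxx !mulr1n kin_central.
congr (_ + _); rewrite !big1 // => k.
  by rewrite !mxE => /negPf ->; rewrite mulr0n mulr0.
by rewrite !mxE eq_sym => /negPf ->; rewrite mulr0n mul0r.
Qed.
Definition mat_alg : kalg K := @KAlg K 'M[A]_n mat_kin mat_kin_central.
End Mat.

End BasicAlgebras.

Arguments self_alg K : clear implicits.

(* Associative, not necessarily unital, k-algebras given by generators X and
   relations: classes of formal expressions under the smallest congruence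
   containing the algebra laws and the relations. *)

Inductive term (k X : Type) : Type :=
| TGen of X
| TZero
| TAdd of term k X & term k X
| TScale of k & term k X
| TMul of term k X & term k X.

Arguments TGen {k X} _.
Arguments TZero {k X}.

HB.instance Definition _ (k X : Type) := gen_eqMixin (term k X).
HB.instance Definition _ (k X : Type) := gen_choiceMixin (term k X).

Section Presentation.

Variables (k : comNzRingType) (X : Type).
Variable rel : term k X -> term k X -> Prop.

Inductive cong : term k X -> term k X -> Prop :=
| cong_rel t u : rel t u -> cong t u
| cong_refl t : cong t t
| cong_sym t u : cong t u -> cong u t
| cong_trans u t w : cong t u -> cong u w -> cong t w
| cong_add t t' u u' : cong t t' -> cong u u' -> cong (TAdd t u) (TAdd t' u')
| cong_scale c t t' : cong t t' -> cong (TScale c t) (TScale c t')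
| cong_mul t t' u u' : cong t t' -> cong u u' -> cong (TMul t u) (TMul t' u')
| cong_addA t u w : cong (TAdd t (TAdd u w)) (TAdd (TAdd t u) w)
| cong_addC t u : cong (TAdd t u) (TAdd u t)
| cong_add0 t : cong (TAdd TZero t) t
| cong_scaleA a b t : cong (TScale a (TScale b t)) (TScale (a * b) t)
| cong_scale0 t : cong (TScale 0 t) TZero
| cong_scale1 t : cong (TScale 1 t) t
| cong_scaleDr c t u :
    cong (TScale c (TAdd t u)) (TAdd (TScale c t) (TScale c u))
| cong_scaleDl a b t :
    cong (TScale (a + b) t) (TAdd (TScale a t) (TScale b t))
| cong_mulA t u w : cong (TMul t (TMul u w)) (TMul (TMul t u) w)
| cong_mulDl t u w : cong (TMul (TAdd t u) w) (TAdd (TMul t w) (TMul u w))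
| cong_mulDr t u w : cong (TMul t (TAdd u w)) (TAdd (TMul t u) (TMul t w))
| cong_scaleAl c t u : cong (TScale c (TMul t u)) (TMul (TScale c t) u)
| cong_scaleAr c t u : cong (TScale c (TMul t u)) (TMul t (TScale c u)).

Definition congb (t u : term k X) : bool := `[< cong t u >].

Fact congb_equiv : equiv_class_of congb.
Proof.
split=> [t|t u|u t w].
- exact/asboolP/cong_refl.
- by apply/asboolP/asboolP => /cong_sym.
- by move=> /asboolP tu /asboolP uw; apply/asboolP/cong_trans/uw.
Qed.
Definition cong_equiv := EquivRelPack congb_equiv.

Definition pres : Type := {eq_quot cong_equiv}.
HB.instance Definition _ := Choice.on pres.
HB.instance Definition _ := EqQuotient.on pres.

Definition cls (t : term k X) : pres := \pi t.

Lemma clsP t u : cls t = cls u <-> cong t u.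
Proof.
split=> [/eqmodP/asboolP //|tu].
by apply/eqmodP/asboolP.
Qed.

Lemma cls_repr (x : pres) : cls (repr x) = x.
Proof. exact: reprK. Qed.

Lemma cong_repr t : cong (repr (cls t)) t.
Proof. by apply/clsP; rewrite cls_repr. Qed.

Lemma pres_ind (P : pres -> Prop) : (forall t, P (cls t)) -> forall x, P x.
Proof. by move=> Pc x; rewrite -(cls_repr x). Qed.

Definition pres_gen (x : X) : pres := cls (TGen x).
Definition pres_zero : pres := cls TZero.
Definition pres_add (x y : pres) : pres := cls (TAdd (repr x) (repr y)).
Definition pres_scale (c : k) (x : pres) : pres := cls (TScale c (repr x)).
Definition pres_opp (x : pres) : pres := pres_scale (-1) x.
Definition pres_mul (x y : pres) : pres := cls (TMul (repr x) (repr y)).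

Lemma pres_addE t u : pres_add (cls t) (cls u) = cls (TAdd t u).
Proof. by apply/clsP; apply: cong_add; apply: cong_repr. Qed.
Lemma pres_scaleE c t : pres_scale c (cls t) = cls (TScale c t).
Proof. by apply/clsP; apply: cong_scale; apply: cong_repr. Qed.
Lemma pres_mulE t u : pres_mul (cls t) (cls u) = cls (TMul t u).
Proof. by apply/clsP; apply: cong_mul; apply: cong_repr. Qed.

Fact pres_addA : associative pres_add.
Proof.
elim/pres_ind=> t; elim/pres_ind=> u; elim/pres_ind=> w.
by rewrite !pres_addE; apply/clsP/cong_addA.
Qed.
Fact pres_addC : commutative pres_add.
Proof.
elim/pres_ind=> t; elim/pres_ind=> u.
by rewrite !pres_addE; apply/clsP/cong_addC.
Qed.
Fact pres_add0 : left_id pres_zero pres_add.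
Proof. by elim/pres_ind=> t; rewrite pres_addE; apply/clsP/cong_add0. Qed.
Fact pres_addN : left_inverse pres_zero pres_opp pres_add.
Proof.
elim/pres_ind=> t; rewrite /pres_opp pres_scaleE pres_addE; apply/clsP.
apply: (cong_trans (u := TAdd (TScale (-1) t) (TScale 1 t))).
  by apply: cong_add; [apply: cong_refl | apply/cong_sym/cong_scale1].
apply: (cong_trans (u := TScale (-1 + 1) t)).
  exact/cong_sym/cong_scaleDl.
by rewrite addNr; apply: cong_scale0.
Qed.
HB.instance Definition _ :=
  GRing.isZmodule.Build pres pres_addA pres_addC pres_add0 pres_addN.

Fact pres_scalerA a b x :
  pres_scale a (pres_scale b x) = pres_scale (a * b) x.
Proof.
by elim/pres_ind: x => t; rewrite !pres_scaleE; apply/clsP/cong_scaleA.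
Qed.
Fact pres_scale1r : left_id 1 pres_scale.
Proof. by elim/pres_ind=> t; rewrite pres_scaleE; apply/clsP/cong_scale1. Qed.
Fact pres_scalerDr : right_distributive pres_scale +%R.
Proof.
move=> c; elim/pres_ind=> t; elim/pres_ind=> u.
rewrite -[cls t + _]/(pres_add _ _) pres_addE !pres_scaleE [RHS]pres_addE.
exact/clsP/cong_scaleDr.
Qed.
Fact pres_scalerDl x : {morph pres_scale^~ x : a b / a + b}.
Proof.
elim/pres_ind: x => t a b; rewrite !pres_scaleE [RHS]pres_addE.
by apply/clsP/cong_scaleDl.
Qed.
HB.instance Definition _ := GRing.Zmodule_isLmodule.Build k pres
  pres_scalerA pres_scale1r pres_scalerDr pres_scalerDl.

Lemma clsD t u : cls (TAdd t u) = cls t + cls u.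
Proof. by rewrite [RHS]pres_addE. Qed.
Lemma cls0 : cls TZero = 0. Proof. by []. Qed.
Lemma clsZ c t : cls (TScale c t) = c *: cls t.
Proof. by rewrite [RHS]pres_scaleE. Qed.

Lemma pres_mulA : associative pres_mul.
Proof.
elim/pres_ind=> t; elim/pres_ind=> u; elim/pres_ind=> w.
by rewrite !pres_mulE; apply/clsP/cong_mulA.
Qed.
Lemma pres_mulDl : left_distributive pres_mul +%R.
Proof.
elim/pres_ind=> t; elim/pres_ind=> u; elim/pres_ind=> w.
by rewrite -(clsD t u) !pres_mulE -clsD; apply/clsP/cong_mulDl.
Qed.
Lemma pres_mulDr : right_distributive pres_mul +%R.
Proof.
elim/pres_ind=> t; elim/pres_ind=> u; elim/pres_ind=> w.
by rewrite -(clsD u w) !pres_mulE -clsD; apply/clsP/cong_mulDr.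
Qed.
Lemma pres_scalerAl (c : k) (x y : pres) :
  c *: pres_mul x y = pres_mul (c *: x) y.
Proof.
elim/pres_ind: x => t; elim/pres_ind: y => u.
by rewrite -(clsZ c t) !pres_mulE -clsZ; apply/clsP/cong_scaleAl.
Qed.
Lemma pres_scalerAr (c : k) (x y : pres) :
  c *: pres_mul x y = pres_mul x (c *: y).
Proof.
elim/pres_ind: x => t; elim/pres_ind: y => u.
by rewrite -(clsZ c u) !pres_mulE -clsZ; apply/clsP/cong_scaleAr.
Qed.
Lemma pres_mul0r : left_zero 0 pres_mul.
Proof. by move=> x; rewrite -{1}(scale0r (0 : pres)) -pres_scalerAl scale0r. Qed.
Lemma pres_mulr0 : right_zero 0 pres_mul.
Proof. by move=> x; rewrite -{1}(scale0r (0 : pres)) -pres_scalerAr scale0r. Qed.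

Lemma pres_elim (P : pres -> Prop) :
  P 0 -> (forall x, P (pres_gen x)) ->
  (forall x y, P x -> P y -> P (x + y)) ->
  (forall c x, P x -> P (c *: x)) ->
  (forall x y, P x -> P y -> P (pres_mul x y)) -> forall x, P x.
Proof.
move=> P0 Pg PD PZ PM; elim/pres_ind; elim=> [x||t Pt u Pu|c t Pt|t Pt u Pu].
- exact: Pg.
- exact: P0.
- by rewrite clsD; apply: PD.
- by rewrite clsZ; apply: PZ.
- by rewrite -pres_mulE; apply: PM.
Qed.

Section Eval.
Variables (T : zmodType) (mul : T -> T -> T) (sc : k -> T -> T) (h : X -> T).

Fixpoint teval (t : term k X) : T :=
  match t with
  | TGen x => h x
  | TZero => 0
  | TAdd t u => teval t + teval u
  | TScale c t => sc c (teval t)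
  | TMul t u => mul (teval t) (teval u)
  end.

Hypotheses (mulA : associative mul) (mulDl : left_distributive mul +%R)
  (mulDr : right_distributive mul +%R).
Hypotheses (scA : forall a b x, sc a (sc b x) = sc (a * b) x)
  (sc1 : forall x, sc 1 x = x)
  (scDr : forall c x y, sc c (x + y) = sc c x + sc c y)
  (scDl : forall a b x, sc (a + b) x = sc a x + sc b x).
Hypotheses (scAl : forall c x y, sc c (mul x y) = mul (sc c x) y)
  (scAr : forall c x y, sc c (mul x y) = mul x (sc c y)).
Hypothesis hrel : forall t u, rel t u -> teval t = teval u.

Lemma teval_cong t u : cong t u -> teval t = teval u.
Proof.
elim=> //=.
- by move=> ? ? ? _ -> _ ->.
- by move=> ? ? ? ? _ -> _ ->.
- by move=> ? ? ? _ ->.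
- by move=> ? ? ? ? _ -> _ ->.
- by move=> *; rewrite addrA.
- by move=> *; rewrite addrC.
- by move=> *; rewrite add0r.
- move=> v; apply: (addrI (sc 0 (teval v))).
  by rewrite -scDl !addr0.
Qed.

Definition pres_eval (x : pres) : T := teval (repr x).

Lemma pres_evalE t : pres_eval (cls t) = teval t.
Proof. exact/teval_cong/cong_repr. Qed.
Lemma pres_eval_gen x : pres_eval (pres_gen x) = h x.
Proof. by rewrite pres_evalE. Qed.
Lemma pres_evalD x y : pres_eval (x + y) = pres_eval x + pres_eval y.
Proof.
elim/pres_ind: x => t; elim/pres_ind: y => u.
by rewrite -clsD !pres_evalE.
Qed.
Lemma pres_evalZ c x : pres_eval (c *: x) = sc c (pres_eval x).
Proof. by elim/pres_ind: x => t; rewrite -clsZ !pres_evalE. Qed.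
Lemma pres_evalM x y : pres_eval (pres_mul x y) = mul (pres_eval x) (pres_eval y).
Proof.
elim/pres_ind: x => t; elim/pres_ind: y => u.
by rewrite pres_mulE !pres_evalE.
Qed.
End Eval.

End Presentation.

Arguments cls {k X} rel t.
Arguments pres_gen {k X} rel x.

Record digraph : Type := Digraph {
  vertex : finType;
  edge : finType;
  src : edge -> vertex;
  rng : edge -> vertex
}.

Section Graph.
Variable E : digraph.
Definition out (v : vertex E) : {set edge E} := [set e | src e == v].
Definition sink : {set vertex E} := [set v | out v == set0].
Definition regular : {set vertex E} := [set v | 0 < #|out v|]%N.
End Graph.

Arguments sink : clear implicits.
Arguments regular : clear implicits.

Inductive lpa_gen (E : digraph) : Type :=
| GV of vertex E
| GE of edge E
| GS of edge E.

Section Leavitt.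

Variables (K : fieldType) (E : digraph).

Local Notation tm := (term K (lpa_gen E)).
Local Notation V v := (TGen (GV v) : tm).
Local Notation "'\e' e" := (TGen (GE e) : tm) (at level 8, e at level 2).
Local Notation "'\s' e" := (TGen (GS e) : tm) (at level 8, e at level 2).

Inductive lpa_rel : tm -> tm -> Prop :=
| rel_vv u v : lpa_rel (TMul (V u) (V v)) (if u == v then V u else TZero)
| rel_se e : lpa_rel (TMul (V (src e)) (\e e)) (\e e)
| rel_er e : lpa_rel (TMul (\e e) (V (rng e))) (\e e)
| rel_rs e : lpa_rel (TMul (V (rng e)) (\s e)) (\s e)
| rel_ss e : lpa_rel (TMul (\s e) (V (src e))) (\s e)
| rel_CK1 e f :
    lpa_rel (TMul (\s e) (\e f)) (if e == f then V (rng e) else TZero)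
| rel_CK2 v : v \in regular E ->
    lpa_rel (\big[@TAdd _ _/TZero]_(e in out v) TMul (\e e) (\s e)) (V v).

Definition lpa : Type := pres lpa_rel.
HB.instance Definition _ := GRing.Lmodule.copy lpa (pres lpa_rel).

Definition lpa_v (v : vertex E) : lpa := pres_gen lpa_rel (GV v).
Definition lpa_e (e : edge E) : lpa := pres_gen lpa_rel (GE e).
Definition lpa_s (e : edge E) : lpa := pres_gen lpa_rel (GS e).

Definition lpa_mul : lpa -> lpa -> lpa := @pres_mul _ _ lpa_rel.
Definition lpa_one : lpa := \sum_(v : vertex E) lpa_v v.

Fact lpa_mulA : associative lpa_mul. Proof. exact: pres_mulA. Qed.
Fact lpa_mulDl : left_distributive lpa_mul +%R. Proof. exact: pres_mulDl. Qed.
Fact lpa_mulDr : right_distributive lpa_mul +%R. Proof. exact: pres_mulDr. Qed.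

Fact lpa_relE t u : lpa_rel t u -> cls lpa_rel t = cls lpa_rel u.
Proof. by move=> tu; apply/clsP/cong_rel. Qed.

Fact lpa_vv u v : lpa_mul (lpa_v u) (lpa_v v) = if u == v then lpa_v u else 0.
Proof.
rewrite [LHS]pres_mulE (lpa_relE (rel_vv u v)); by case: ifP.
Qed.
Fact lpa_se e : lpa_mul (lpa_v (src e)) (lpa_e e) = lpa_e e.
Proof. by rewrite [LHS]pres_mulE (lpa_relE (rel_se e)). Qed.
Fact lpa_er e : lpa_mul (lpa_e e) (lpa_v (rng e)) = lpa_e e.
Proof. by rewrite [LHS]pres_mulE (lpa_relE (rel_er e)). Qed.
Fact lpa_rs e : lpa_mul (lpa_v (rng e)) (lpa_s e) = lpa_s e.
Proof. by rewrite [LHS]pres_mulE (lpa_relE (rel_rs e)). Qed.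
Fact lpa_ss e : lpa_mul (lpa_s e) (lpa_v (src e)) = lpa_s e.
Proof. by rewrite [LHS]pres_mulE (lpa_relE (rel_ss e)). Qed.

Fact lpa_mul0r : left_zero 0 lpa_mul. Proof. exact: pres_mul0r. Qed.
Fact lpa_mulr0 : right_zero 0 lpa_mul. Proof. exact: pres_mulr0. Qed.

Fact lpa_mul_suml (F : vertex E -> lpa) x :
  lpa_mul (\sum_v F v) x = \sum_v lpa_mul (F v) x.
Proof.
apply: (big_morph (lpa_mul^~ x)) => [y z|]; first exact: lpa_mulDl.
exact: lpa_mul0r.
Qed.
Fact lpa_mul_sumr (F : vertex E -> lpa) x :
  lpa_mul x (\sum_v F v) = \sum_v lpa_mul x (F v).
Proof.
apply: (big_morph (lpa_mul x)) => [y z|]; first exact: lpa_mulDr.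
exact: lpa_mulr0.
Qed.

Fact lpa_one_fixl v x :
  lpa_mul (lpa_v v) x = x -> lpa_mul lpa_one x = x.
Proof.
move=> vx; rewrite -vx lpa_mulA; congr lpa_mul.
rewrite lpa_mul_suml (bigD1 v) //= lpa_vv eqxx big1 ?addr0 // => u.
by rewrite lpa_vv => /negPf ->.
Qed.
Fact lpa_one_fixr v x :
  lpa_mul x (lpa_v v) = x -> lpa_mul x lpa_one = x.
Proof.
move=> vx; rewrite -vx -lpa_mulA; congr lpa_mul.
rewrite lpa_mul_sumr (bigD1 v) //= lpa_vv eqxx big1 ?addr0 // => u.
by rewrite lpa_vv eq_sym => /negPf ->.
Qed.

Fact lpa_mul1r : left_id lpa_one lpa_mul.
Proof.
elim/pres_elim=> [|[v|e|e]|x y Px Py|c x Px|x y Px Py].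
- exact: lpa_mulr0.
- by apply: (@lpa_one_fixl v); rewrite lpa_vv eqxx.
- exact: (lpa_one_fixl (lpa_se e)).
- exact: (lpa_one_fixl (lpa_rs e)).
- by rewrite lpa_mulDr Px Py.
- by rewrite /lpa_mul -pres_scalerAr; congr (_ *: _).
- by rewrite lpa_mulA Px.
Qed.
Fact lpa_mulr1 : right_id lpa_one lpa_mul.
Proof.
elim/pres_elim=> [|[v|e|e]|x y Px Py|c x Px|x y Px Py].
- exact: lpa_mul0r.
- by apply: (@lpa_one_fixr v); rewrite lpa_vv eqxx.
- exact: (lpa_one_fixr (lpa_er e)).
- exact: (lpa_one_fixr (lpa_ss e)).
- by rewrite lpa_mulDl Px Py.
- by rewrite /lpa_mul -pres_scalerAl; congr (_ *: _).
- by rewrite -[RHS]/(lpa_mul x y) -{2}Py lpa_mulA.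
Qed.

HB.instance Definition _ := GRing.Zmodule_isPzRing.Build lpa
  lpa_mulA lpa_mul1r lpa_mulr1 lpa_mulDl lpa_mulDr.

Fact lpa_scalerAl (c : K) (x y : lpa) : c *: (x * y) = (c *: x) * y.
Proof. exact: pres_scalerAl. Qed.
Fact lpa_scalerAr (c : K) (x y : lpa) : c *: (x * y) = x * (c *: y).
Proof. exact: pres_scalerAr. Qed.

Definition lpa_kin (c : K) : lpa := c *: (1 : lpa).
Fact lpa_kin_nmod : lpa_kin 0 = 0 /\ {morph lpa_kin : x y / x + y}.
Proof. by split=> [|x y]; rewrite /lpa_kin ?scale0r ?scalerDl. Qed.
Fact lpa_kin_monoid : lpa_kin 1 = 1 /\ {morph lpa_kin : x y / x * y}.
Proof.
split=> [|x y]; rewrite /lpa_kin ?scale1r //.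
by rewrite -lpa_scalerAl mul1r scalerA.
Qed.
HB.instance Definition _ :=
  GRing.isNmodMorphism.Build K lpa lpa_kin lpa_kin_nmod.
HB.instance Definition _ :=
  GRing.isMonoidMorphism.Build K lpa lpa_kin lpa_kin_monoid.
Fact lpa_kin_central (c : K) (x : lpa) : lpa_kin c * x = x * lpa_kin c.
Proof. by rewrite /lpa_kin -lpa_scalerAl -lpa_scalerAr mul1r mulr1. Qed.
Definition lpa_alg : kalg K := @KAlg K lpa lpa_kin lpa_kin_central.

End Leavitt.

(* Coproduct of the R0-rings f : R0 -> A and g : R0 -> B: the ring generated
   by the elements of A and of B subject to the relations making A and B map
   to it by ring homomorphisms that agree on R0.  No relation about units is
   needed: 1_A = f 1 and 1_B = g 1 are identified, and their common image is
   the unit.  Rings are presented as int-algebras. *)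
Section Coproduct.

Variables (R0 A B : pzRingType).
Variables (f : {rmorphism R0 -> A}) (g : {rmorphism R0 -> B}).

Local Notation tm := (term int (A + B)).
Local Notation L a := (TGen (inl a) : tm).
Local Notation R b := (TGen (inr b) : tm).

Inductive coprod_rel : tm -> tm -> Prop :=
| cop_addl a a' : coprod_rel (TAdd (L a) (L a')) (L (a + a'))
| cop_mull a a' : coprod_rel (TMul (L a) (L a')) (L (a * a'))
| cop_addr b b' : coprod_rel (TAdd (R b) (R b')) (R (b + b'))
| cop_mulr b b' : coprod_rel (TMul (R b) (R b')) (R (b * b'))
| cop_amalg r : coprod_rel (L (f r)) (R (g r)).

Definition coprod : Type := pres coprod_rel.
HB.instance Definition _ := GRing.Zmodule.copy coprod (pres coprod_rel).

Definition coprod_inl (a : A) : coprod := pres_gen coprod_rel (inl a).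
Definition coprod_inr (b : B) : coprod := pres_gen coprod_rel (inr b).
Definition coprod_mul : coprod -> coprod -> coprod := @pres_mul _ _ coprod_rel.
Definition coprod_one : coprod := coprod_inl 1.

Fact coprod_relE t u : coprod_rel t u -> cls coprod_rel t = cls coprod_rel u.
Proof. by move=> tu; apply/clsP/cong_rel. Qed.

Fact coprod_inlD a a' : coprod_inl (a + a') = coprod_inl a + coprod_inl a'.
Proof. rewrite [RHS]pres_addE; exact/esym/coprod_relE/cop_addl. Qed.
Fact coprod_inrD b b' : coprod_inr (b + b') = coprod_inr b + coprod_inr b'.
Proof. rewrite [RHS]pres_addE; exact/esym/coprod_relE/cop_addr. Qed.
Fact coprod_inlM a a' :
  coprod_inl (a * a') = coprod_mul (coprod_inl a) (coprod_inl a').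
Proof. rewrite [RHS]pres_mulE; exact/esym/coprod_relE/cop_mull. Qed.
Fact coprod_inrM b b' :
  coprod_inr (b * b') = coprod_mul (coprod_inr b) (coprod_inr b').
Proof. rewrite [RHS]pres_mulE; exact/esym/coprod_relE/cop_mulr. Qed.
Lemma coprod_amalg r : coprod_inl (f r) = coprod_inr (g r).
Proof. exact: (coprod_relE (cop_amalg r)). Qed.
Fact coprod_oneE : coprod_one = coprod_inr 1.
Proof. by rewrite /coprod_one -(rmorph1 f) coprod_amalg rmorph1. Qed.

Fact coprod_mulA : associative coprod_mul. Proof. exact: pres_mulA. Qed.
Fact coprod_mulDl : left_distributive coprod_mul +%R.
Proof. exact: pres_mulDl. Qed.
Fact coprod_mulDr : right_distributive coprod_mul +%R.
Proof. exact: pres_mulDr. Qed.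
Fact coprod_mul1r : left_id coprod_one coprod_mul.
Proof.
elim/pres_elim=> [|[a|b]|x y Px Py|c x Px|x y Px Py].
- exact: pres_mulr0.
- by rewrite -coprod_inlM mul1r.
- by rewrite coprod_oneE -coprod_inrM mul1r.
- by rewrite coprod_mulDr Px Py.
- by rewrite /coprod_mul -pres_scalerAr; congr (_ *: _).
- by rewrite coprod_mulA Px.
Qed.
Fact coprod_mulr1 : right_id coprod_one coprod_mul.
Proof.
elim/pres_elim=> [|[a|b]|x y Px Py|c x Px|x y Px Py].
- exact: pres_mul0r.
- by rewrite -coprod_inlM mulr1.
- by rewrite coprod_oneE -coprod_inrM mulr1.
- by rewrite coprod_mulDl Px Py.
- by rewrite /coprod_mul -pres_scalerAl; congr (_ *: _).
- by rewrite -[RHS]/(coprod_mul x y) -{2}Py coprod_mulA.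
Qed.
HB.instance Definition _ := GRing.Zmodule_isPzRing.Build coprod
  coprod_mulA coprod_mul1r coprod_mulr1 coprod_mulDl coprod_mulDr.

Fact coprod_inl0 : coprod_inl 0 = 0.
Proof. by apply: (addrI (coprod_inl 0)); rewrite -coprod_inlD !addr0. Qed.
Fact coprod_inr0 : coprod_inr 0 = 0.
Proof. by apply: (addrI (coprod_inr 0)); rewrite -coprod_inrD !addr0. Qed.
HB.instance Definition _ := GRing.isNmodMorphism.Build A coprod coprod_inl
  (coprod_inl0, coprod_inlD).
HB.instance Definition _ := GRing.isMonoidMorphism.Build A coprod coprod_inl
  (erefl, coprod_inlM).
HB.instance Definition _ := GRing.isNmodMorphism.Build B coprod coprod_inr
  (coprod_inr0, coprod_inrD).
HB.instance Definition _ := GRing.isMonoidMorphism.Build B coprod coprod_inr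
  (esym coprod_oneE, coprod_inrM).

Lemma coprod_elim (P : coprod -> Prop) :
  P 0 -> (forall a, P (coprod_inl a)) -> (forall b, P (coprod_inr b)) ->
  (forall x y, P x -> P y -> P (x + y)) -> (forall x, P x -> P (- x)) ->
  (forall x y, P x -> P y -> P (x * y)) -> forall x, P x.
Proof.
move=> P0 Pl Pr PD PN PM; elim/pres_elim=> // [[a|b]|c x Px]; first exact: Pl.
  exact: Pr.
have Pn n : P (x *+ n).
  by elim: n => [|n IHn]; rewrite ?mulr0n // mulrS; apply: PD.
suff -> : c *: x = (x : coprod) *~ c by case: c => n; [|apply: PN]; apply: Pn.
by rewrite -[in LHS](intz c) scaler_int.
Qed.

Theorem coprod_universal (T : pzRingType) (h : {rmorphism A -> T})
    (k : {rmorphism B -> T}) : (forall r, h (f r) = k (g r)) ->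
  (exists u : {rmorphism coprod -> T},
     u \o coprod_inl =1 h /\ u \o coprod_inr =1 k) /\
  (forall u u' : {rmorphism coprod -> T},
     u \o coprod_inl =1 u' \o coprod_inl ->
     u \o coprod_inr =1 u' \o coprod_inr -> u =1 u').
Proof.
move=> hk; split; last first.
  move=> u u' ul ur; elim/coprod_elim=> //.
  - by rewrite !rmorph0.
  - by move=> x y ux uy; rewrite !rmorphD ux uy.
  - by move=> x ux; rewrite !rmorphN ux.
  - by move=> x y ux uy; rewrite !rmorphM ux uy.
pose hh (x : A + B) : T := match x with inl a => h a | inr b => k b end.
pose sc (c : int) (x : T) := x *~ c.
pose u0 : coprod -> T := @pres_eval _ _ coprod_rel T *%R sc hh.
have rl t u : coprod_rel t u -> teval *%R sc hh t = teval *%R sc hh u.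
  by case=> [a a'|a a'|b b'|b b'|r] /=; rewrite ?rmorphD ?rmorphM.
have scA a b x : sc a (sc b x) = sc (a * b) x by rewrite /sc mulrC mulrzA.
have scDr c x y : sc c (x + y) = sc c x + sc c y by exact: mulrzDl.
have scDl a b x : sc (a + b) x = sc a x + sc b x by exact: mulrzDr.
have scAl c x y : sc c (x * y) = sc c x * y by rewrite /sc mulrzAl.
have scAr c x y : sc c (x * y) = x * sc c y by rewrite /sc mulrzAr.
have u0D x y : u0 (x + y) = u0 x + u0 y.
  exact: (pres_evalD (@mulrA T) (@mulrDl T) (@mulrDr T)).
have u0M x y : u0 (x * y) = u0 x * u0 y.
  exact: (pres_evalM (@mulrA T) (@mulrDl T) (@mulrDr T)).
have u0g x : u0 (pres_gen coprod_rel x) = hh x.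
  exact: (pres_eval_gen (@mulrA T) (@mulrDl T) (@mulrDr T)).
have u00 : u0 0 = 0 by apply: (addrI (u0 0)); rewrite -u0D !addr0.
have u01 : u0 1 = 1 by rewrite [LHS]u0g /= rmorph1.
pose m1 := GRing.isNmodMorphism.Build coprod T u0 (u00, u0D).
pose m2 := GRing.isMonoidMorphism.Build coprod T u0 (u01, u0M).
pose u : {rmorphism coprod -> T} := HB.pack u0 m1 m2.
by exists u; split=> x; apply: u0g.
Qed.

End Coproduct.

(* When f and g are morphisms of K-algebras, the coproduct of R0-rings is a
   K-algebra through K -> R0 -> coprod f g. *)
Section CoproductAlgebra.

Variables (K : comPzRingType) (R0 A B : kalg K).
Variables (f : algHom R0 A) (g : algHom R0 B).

Definition coprod_kin : {rmorphism K -> coprod f g} :=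
  coprod_inl f g \o (f \o kin R0).

Fact coprod_kin_central (c : K) (x : coprod f g) :
  coprod_kin c * x = x * coprod_kin c.
Proof.
rewrite /coprod_kin /=.
elim/coprod_elim: x => [|a|b|x y cx cy|x cx|x y cx cy].
- by rewrite mul0r mulr0.
- by rewrite -!rmorphM algHom_kin kin_central.
- by rewrite coprod_amalg -!rmorphM algHom_kin kin_central.
- by rewrite mulrDr mulrDl cx cy.
- by rewrite mulrN mulNr cx.
- by rewrite mulrA cx -[LHS]mulrA cy mulrA.
Qed.
Definition coprod_alg : kalg K :=
  @KAlg K (coprod f g) coprod_kin coprod_kin_central.

End CoproductAlgebra.

Section OrthogonalIdempotents.

Variables (K : comPzRingType) (A : kalg K) (I : finType) (e : I -> A).
Hypothesis orth : forall s t, e s * e t = if s == t then e s else 0.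

Definition comb (x : I -> K) (x0 : K) : A :=
  \sum_s e s * kin A (x s) + (1 - \sum_s e s) * kin A x0.

Lemma comb_ext x x' x0 x0' : x =1 x' -> x0 = x0' -> comb x x0 = comb x' x0'.
Proof. by move=> /funext -> ->. Qed.

Lemma combE x x0 : comb x x0 = \sum_s e s * kin A (x s - x0) + kin A x0.
Proof.
rewrite /comb mulrBl mul1r mulr_suml [kin A x0 - _]addrC addrA -sumrB.
by congr (_ + _); apply: eq_bigr => s _; rewrite -mulrBr -rmorphB.
Qed.

Lemma comb_const c : comb (fun=> c) c = kin A c.
Proof.
by rewrite combE big1 ?add0r // => s _; rewrite subrr rmorph0 mulr0.
Qed.

Lemma combD x y x0 y0 :
  comb (fun s => x s + y s) (x0 + y0) = comb x x0 + comb y y0.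
Proof.
rewrite !combE rmorphD addrACA -big_split /=; congr (_ + _).
by apply: eq_bigr => s _; rewrite -mulrDr -rmorphD opprD addrACA.
Qed.

Lemma combM x y x0 y0 :
  comb (fun s => x s * y s) (x0 * y0) = comb x x0 * comb y y0.
Proof.
rewrite !combE mulrDl !mulrDr -rmorphM addrA; congr (_ + _).
rewrite !mulr_suml mulr_sumr -!big_split /=; apply: eq_bigr => s _.
rewrite mulr_sumr (bigD1 s) //= big1 => [|t ts]; last first.
  rewrite mulrA -[e s * _ * _]mulrA kin_central mulrA orth eq_sym (negPf ts).
  by rewrite !mul0r.
rewrite addr0 mulrA -[e s * _ * e s]mulrA kin_central mulrA orth eqxx.
rewrite [kin A x0 * _]mulrA [kin A x0 * e s]kin_central -!mulrA -!mulrDr.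
rewrite -rmorphD subrK -!rmorphM -rmorphD; congr (_ * kin A _).
by rewrite mulrBl mulrBr addrA subrK.
Qed.

End OrthogonalIdempotents.

(* Enumerations v_i of the vertices, regular ones first, and f_(i,j) of the
   edges with source v_i.  Indices start at 0. *)
Record labelling (E : digraph) (p q : nat) := Labelling {
  lab_v : 'I_q -> vertex E;
  lab_f : forall i : 'I_q, 'I_#|out (lab_v i)| -> edge E;
  lab_v_bij : bijective lab_v;
  lab_v_reg : forall i : 'I_q, (i < p)%N -> lab_v i \in regular E;
  lab_v_sink : forall i : 'I_q, (p <= i)%N -> lab_v i \in sink E;
  lab_f_inj : forall i, injective (@lab_f i);
  lab_f_out : forall i e, (e \in out (lab_v i)) <-> (exists j : 'I_#|out (lab_v i)|, lab_f j = e)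
}.

Lemma labelling_exists (E : digraph) :
  inhabited (labelling E #|regular E| #|vertex E|).
Proof.
pose s := enum (regular E) ++ enum (sink E).
have sinkC : sink E =i [predC regular E].
  by move=> u; rewrite !inE lt0n negbK cards_eq0.
have sz : size s == #|vertex E|.
  rewrite size_cat -!cardE (eq_card sinkC) -(cardC (mem (regular E))).
  exact: eqxx.
have us : uniq s.
  rewrite cat_uniq !enum_uniq andbT /= -all_predC; apply/allP => u /=.
  by rewrite !mem_enum sinkC.
pose t := Tuple sz; pose v (i : 'I_#|vertex E|) := tnth t i.
have v_inj : injective v by apply/tuple_uniqP.
have v_nth i u : v i = nth u s i by rewrite /v (tnth_nth u).
constructor; apply: (@Labelling E _ _ v (fun i j => enum_val j)).
- by apply: inj_card_bij v_inj _; rewrite card_ord.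
- move=> i ip; rewrite (v_nth i (v i)) nth_cat -cardE ip -mem_enum.
  by rewrite mem_nth // -cardE.
- move=> i pi; rewrite (v_nth i (v i)) nth_cat -cardE ltnNge pi /= -mem_enum.
  rewrite mem_nth // -cardE ltn_subLR //; move: (ltn_ord i) => /leq_trans -> //.
  by rewrite -(eqP sz) size_cat -!cardE.
- by move=> i; apply: enum_val_inj.
- move=> i e; split=> [ei|[j <-]]; last exact: enum_valP.
  by exists (enum_rank_in ei e); rewrite enum_rankK_in.
Qed.

Section Maps.

Variables (K : fieldType) (E : digraph) (n p q : nat) (lab : labelling E p q).

Local Notation KE0 := (pow_alg (vertex E) (self_alg K)).
Local Notation v := (lab_v lab).
Local Notation m i := #|out (v i)|.

Definition base_alg : kalg K := pow_alg 'I_(p + q).+1 (self_alg K).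
Definition mat_side : kalg K := mat_alg n KE0.
Definition prod_side : kalg K :=
  prod_alg (pow_alg 'I_p (mat_alg 2 (self_alg K)))
           (pow_alg 'I_(q - p).+1 (self_alg K)).

Definition alpha (u : vertex E) : {ffun vertex E -> K} :=
  [ffun w => (w == u)%:R].

(* Matrix positions start at 0. *)
Definition eps (k : nat) (u : vertex E) : mat_side :=
  \matrix_(a < n, b < n) if (a == k :> nat) && (b == k :> nat) then alpha u
                         else 0.

Definition mhat (i : 'I_q) : nat := \sum_(l < q | (l < i)%N) (m l).+1.

Definition eP (i : 'I_q) : mat_side := eps (mhat i) (v i).
Definition eQ (i : 'I_q) : mat_side :=
  \sum_(j < m i) eps (mhat i + j.+1)%N (rng (lab_f j)).
Definition eS (i : 'I_q) : mat_side := eps (mhat i) (v i).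
Definition e0 : mat_side :=
  1 - \sum_(i < q | (i < p)%N) (eP i + eQ i) - \sum_(i < q | (p <= i)%N) eS i.

Local Notation "x '`[' k ]" := (x (inord k)) (at level 2).

(* Coordinates x_0, ..., x_(p+q); inord is only applied in that range when
   p <= q. *)
Definition mat_map (x : {ffun 'I_(p + q).+1 -> K}) : mat_side :=
  \sum_(i < q | (i < p)%N)
     (eP i * kin _ x`[i.*2] + eQ i * kin _ x`[i.*2.+1])
  + \sum_(i < q | (p <= i)%N) eS i * kin _ x`[(p + i)%N]
  + e0 * kin _ x`[(p + q)%N].

Definition prod_map (x : {ffun 'I_(p + q).+1 -> K}) : prod_side :=
  ([ffun i : 'I_p => x`[i.*2] *: delta_mx 0 0 + x`[i.*2.+1] *: delta_mx 1 1],
   [ffun j : 'I_(q - p).+1 => x`[(p.*2 + j)%N]]).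

Fact alphaM u w : alpha u * alpha w = if u == w then alpha u else 0.
Proof.
apply/ffunP=> z; rewrite !ffunE; case: (eqVneq u w) => [<-|uw]; rewrite !ffunE.
  by case: (z == u); rewrite ?mulr1 ?mulr0.
case: (eqVneq z u) => [->|_]; last by rewrite mul0r.
by rewrite (negPf uw) mulr0.
Qed.

Fact eps_orth k u l w :
  eps k u * eps l w = if (k == l) && (u == w) then eps k u else 0.
Proof.
apply/matrixP=> a b; rewrite mxE (bigD1 a) //= big1 => [|c ca]; last first.
  rewrite !mxE [X in X * _ = _]ifF ?mul0r //.
  apply/negP=> /andP[/eqP ak /eqP ck]; case/eqP: ca.
  by apply: val_inj; rewrite /= ck.
rewrite addr0 !mxE andbb.
case: (eqVneq k l) => [<-|kl] /=; last first.
  rewrite mxE; case: (eqVneq (a : nat) k) => [->|_]; last by rewrite mul0r.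
  by rewrite (negPf kl) mulr0.
have [ak|ak] /= := eqVneq (a : nat) k; last first.
  by rewrite mul0r; case: ifP; rewrite mxE // (negPf ak).
have [bk|bk] /= := eqVneq (b : nat) k; last first.
  by rewrite mulr0; case: ifP; rewrite mxE // (negPf bk) andbF.
rewrite alphaM; case: ifP => _; rewrite mxE //.
by rewrite ak bk !eqxx.
Qed.

Fact mhat_lt (i i' : 'I_q) (c : nat) :
  (i < i')%N -> (c <= m i)%N -> (mhat i + c < mhat i')%N.
Proof.
move=> ii' cm; rewrite /mhat (bigD1 i (P := fun l : 'I_q => (l < i')%N)) //=.
rewrite -[X in (X <= _)%N]addnS addnC; apply: leq_add => //.
rewrite [X in (_ <= X)%N](bigID (fun l : 'I_q => (l < i)%N)) /=.
set S := (X in (_ <= X + _)%N); suff -> : S = \sum_(l < q | (l < i)%N) (m l).+1.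
  exact: leq_addr.
apply: eq_bigl => l.
case: (ltnP l i) => li; last by rewrite andbF.
by rewrite (ltn_trans li ii') -val_eqE /= neq_ltn li.
Qed.

Fact mhat_inj (i i' : 'I_q) (c c' : nat) : (c <= m i)%N -> (c' <= m i')%N ->
  (mhat i + c = mhat i' + c')%N -> i = i' /\ c = c'.
Proof.
move=> cm cm' eq; case: (ltngtP i i') => [ii'|ii'|/val_inj ii'].
- have := leq_trans (mhat_lt ii' cm) (leq_addr c' _); rewrite eq ltnn //.
- have := leq_trans (mhat_lt ii' cm') (leq_addr c _); rewrite eq ltnn //.
- by move: eq; rewrite -ii' => /addnI.
Qed.

Definition family (s : 'I_q * bool) : mat_side :=
  if s.2 then eQ s.1 else eP s.1.

Fact family_orth s t :
  family s * family t = if s == t then family s else 0.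
Proof.
case: s t => [i [|]] [i' [|]]; rewrite /family /eP /eQ /=.
- rewrite mulr_suml; case: eqP => [[<-]|ii'].
    apply: eq_bigr => j _; rewrite mulr_sumr (bigD1 j) //= eps_orth !eqxx.
    rewrite big1 ?addr0 // => j' jj'; rewrite eps_orth ifF //.
    apply/negP=> /andP[/eqP/addnI[/val_inj jj] _].
    by rewrite jj eqxx in jj'.
  rewrite big1 // => j _; rewrite mulr_sumr big1 // => j' _.
  rewrite eps_orth ifF //; apply/negP=> /andP[/eqP eq _]; apply: ii'.
  have [e _] := mhat_inj (ltn_ord j) (ltn_ord j') eq.
  by congr (_, _).
- rewrite ifF ?mulr_suml ?big1 //; last by apply/eqP=> - [].
  move=> j _; rewrite eps_orth ifF //; apply/negP=> /andP[/eqP eq _].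
  rewrite -[RHS]addn0 in eq.
  by case: (mhat_inj (ltn_ord j) (leq0n _) eq).
- rewrite ifF ?mulr_sumr ?big1 //; last by apply/eqP=> - [].
  move=> j _; rewrite eps_orth ifF //; apply/negP=> /andP[/eqP eq _].
  rewrite -[LHS]addn0 in eq.
  by case: (mhat_inj (leq0n _) (ltn_ord j) eq).
- rewrite eps_orth; case: eqP => [eq|ne] /=.
    have eq' : (mhat i + 0 = mhat i' + 0)%N by rewrite !addn0.
    by have [<- _] := mhat_inj (leq0n _) (leq0n _) eq'; rewrite !eqxx.
  by case: eqP => // -[ii']; rewrite ii' in ne.
Qed.

Definition slot (s : 'I_q * bool) : nat :=
  if (s.1 < p)%N then (if s.2 then s.1.*2.+1 else s.1.*2) else (p + s.1)%N.

Fact eQ_sink (i : 'I_q) : (p <= i)%N -> eQ i = 0.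
Proof.
move=> /(lab_v_sink lab); rewrite inE /eQ => /eqP mi.
by apply: big1 => j; have := ltn_ord j; rewrite {2}mi cards0.
Qed.

Fact family_sum (F : 'I_q * bool -> mat_side) :
  (forall i : 'I_q, (p <= i)%N -> F (i, true) = 0) ->
  \sum_s F s = \sum_(i < q | (i < p)%N) (F (i, false) + F (i, true))
              + \sum_(i < q | (p <= i)%N) F (i, false).
Proof.
move=> F0; have -> : \sum_s F s = \sum_i \sum_b F (i, b).
  by rewrite pair_bigA /=; apply: eq_bigr; case.
rewrite (bigID (fun i : 'I_q => (i < p)%N)) /=; congr (_ + _).
  by apply: eq_bigr => i _; rewrite big_bool addrC.
rewrite (eq_bigl (fun i : 'I_q => (p <= i)%N)) => [|i]; last by rewrite -leqNgt.
by apply: eq_bigr => i pi; rewrite big_bool /= F0 // add0r.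
Qed.

Fact mat_mapE x :
  mat_map x = comb family (fun s => x`[slot s]) x`[(p + q)%N].
Proof.
have f0 (i : 'I_q) : (p <= i)%N -> family (i, true) = 0 by exact: eQ_sink.
have e0E : 1 - \sum_s family s = e0 by rewrite (family_sum f0) opprD addrA.
rewrite /comb e0E family_sum => [|i pi]; last by rewrite f0 ?mul0r.
rewrite /mat_map; apply: (f_equal2 +%R); last exact: erefl.
apply: (f_equal2 +%R); apply: eq_bigr => i.
  by rewrite /slot /= => ->.
by rewrite /slot leqNgt /= => /negPf ->.
Qed.

Fact mat_map_nmod : mat_map 0 = 0 /\ {morph mat_map : x y / x + y}.
Proof.
split=> [|x y]; rewrite !mat_mapE.
  rewrite -(rmorph0 (kin mat_side)) -(comb_const family).
  by apply: comb_ext => [s|]; rewrite ffunE.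
by rewrite -combD; apply: comb_ext => [s|]; rewrite ffunE.
Qed.
Fact mat_map_monoid : mat_map 1 = 1 /\ {morph mat_map : x y / x * y}.
Proof.
split=> [|x y]; rewrite !mat_mapE.
  rewrite -(rmorph1 (kin mat_side)) -(comb_const family).
  by apply: comb_ext => [s|]; rewrite ffunE.
by rewrite -(combM family_orth); apply: comb_ext => [s|]; rewrite ffunE.
Qed.
HB.instance Definition _ :=
  GRing.isNmodMorphism.Build base_alg mat_side mat_map mat_map_nmod.
HB.instance Definition _ :=
  GRing.isMonoidMorphism.Build base_alg mat_side mat_map mat_map_monoid.
Fact mat_map_kin (c : K) : mat_map (kin base_alg c) = kin mat_side c.
Proof.
rewrite mat_mapE -(comb_const family).
by apply: comb_ext => [s|]; rewrite ffunE.
Qed.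
Definition mat_hom : algHom base_alg mat_side :=
  @AlgHom K base_alg mat_side mat_map mat_map_kin.

Fact diag2M (a b c d : K) :
  (a *: delta_mx 0 0 + b *: delta_mx 1 1) * (c *: delta_mx 0 0 + d *: delta_mx 1 1)
  = (a * c) *: delta_mx 0 0 + (b * d) *: delta_mx 1 1 :> 'M[K]_2.
Proof.
rewrite mulrDl !mulrDr -!scalerAl -!scalerAr -![delta_mx _ _ * _]/(_ *m _).
by rewrite !mul_delta_mx_cond !eqxx !mulr0n !scaler0 addr0 add0r !scalerA.
Qed.
Fact diag2_const (c : K) :
  c *: delta_mx 0 0 + c *: delta_mx 1 1 = c%:M :> 'M[K]_2.
Proof.
apply/matrixP=> i j; rewrite !mxE.
by case: i j => [[|[|//]] ?] [[|[|//]] ?];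
   rewrite ?mulr0 ?mulr1 ?addr0 ?add0r.
Qed.

Fact prod_map_nmod : prod_map 0 = 0 /\ {morph prod_map : x y / x + y}.
Proof.
split=> [|x y]; congr (_, _); apply/ffunP=> i; rewrite !ffunE //.
  by rewrite !scale0r addr0.
by rewrite !scalerDl addrACA.
Qed.
Fact prod_map_monoid : prod_map 1 = 1 /\ {morph prod_map : x y / x * y}.
Proof.
split=> [|x y]; congr (_, _); apply/ffunP=> i; rewrite !ffunE //.
  exact: diag2_const.
by rewrite diag2M.
Qed.
HB.instance Definition _ :=
  GRing.isNmodMorphism.Build base_alg prod_side prod_map prod_map_nmod.
HB.instance Definition _ :=
  GRing.isMonoidMorphism.Build base_alg prod_side prod_map prod_map_monoid.
Fact prod_map_kin (c : K) : prod_map (kin base_alg c) = kin prod_side c.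
Proof.
by congr (_, _); apply/ffunP=> i; rewrite !ffunE // diag2_const.
Qed.
Definition prod_hom : algHom base_alg prod_side :=
  @AlgHom K base_alg prod_side prod_map prod_map_kin.

End Maps.

(* Main.v *)
From HB Require Import structures.
Require Import Defs.
From mathcomp Require Import all_boot all_order all_algebra zify.

Set Implicit Arguments.
Unset Strict Implicit.
Unset Printing Implicit Defensive.

Import GRing.Theory.
Local Open Scope ring_scope.

(** The two algebras represent the same functor.

    For idempotents P and Q of a ring, call a pair (x, y) with x y = P, y x = Q,
    P x = x and Q y = y an inverse pair: it is an isomorphism between the right
    ideals generated by P and by Q.  Write M for the matrix algebra over the
    product algebra of K indexed by the vertices.  To each regular vertex v_i
    belong idempotents P_i and Q_i of M: P_i has v_i at one diagonal position,
    and Q_i has the ranges of the edges leaving v_i at further diagonal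
    positions.  Consider the K-algebras T under M together with an inverse pair
    (x_i, y_i) for the images of P_i and Q_i, one for each i.

    - The coproduct is initial among them.  Over the base algebra of diagonal
      elements, the algebra of 2 x 2 blocks is obtained by freely adjoining an
      inverse pair between the two diagonal units of each block
      (prod_side_universal, prod_side_ext); amalgamation moves these pairs to
      P_i and Q_i (coprod_block_universal, coprod_block_ext).

    - The matrix algebra over the Leavitt path algebra is initial too.  Its
      pair is the row of the edges leaving v_i and the column of their ghosts:
      row times column is P_i by the second Cuntz-Krieger relation, and column
      times row is Q_i by the first (inverse_pair_edges).  In the other
      direction, T contains the matrix units of M, so it is a matrix ring over
      their centraliser.  The entries of x_i and y_i in that centraliser satisfy
      the relations of the Leavitt path algebra, and this defines the map to T
      (mat_lpa_universal).  Uniqueness holds because these entries and the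
      image of M generate (mat_lpa_ext).

    Two initial objects are isomorphic. *)

(** * Inverse pairs and matrix units *)

Lemma algHom_isomorphic (K : comPzRingType) (A B : kalg K)
    (u : algHom A B) (w : algHom B A) :
  cancel u w -> cancel w u -> alg_isomorphic A B.
Proof. by move=> uw wu; exists u; exists w. Qed.

(** Off-diagonal terms vanish: the form in which orthogonality of idempotents
    and of matrix units enters the computations below. *)
Lemma mulr_sum_orth (R : pzRingType) (I : finType) (S : pred I) (F G : I -> R) :
  (forall i j, i != j -> F i * G j = 0) ->
  (\sum_(i | S i) F i) * (\sum_(i | S i) G i) = \sum_(i | S i) F i * G i.
Proof.
move=> FG0; rewrite mulr_suml; apply: eq_bigr => i Si.
rewrite mulr_sumr (bigD1 i) //= big1 ?addr0 // => j /andP[_ ji].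
by rewrite FG0 // eq_sym.
Qed.

(** Left multiplication by x and y gives mutually inverse isomorphisms between
    Q R and P R.  The two remaining absorption laws follow. *)
Definition inverse_pair (R : pzRingType) (P Q x y : R) : Prop :=
  [/\ x * y = P, y * x = Q, P * x = x & Q * y = y].

Lemma inverse_pairR (R : pzRingType) (P Q x y : R) :
  inverse_pair P Q x y -> x * Q = x /\ y * P = y.
Proof.
case=> xy yx Px Qy; split; first by rewrite -yx mulrA xy Px.
by rewrite -xy mulrA yx Qy.
Qed.

Lemma inverse_pair_rmorph (R S : pzRingType) (h : {rmorphism R -> S}) P Q x y :
  inverse_pair P Q x y -> inverse_pair (h P) (h Q) (h x) (h y).
Proof. by case=> xy yx Px Qy; split; rewrite -rmorphM ?xy ?yx ?Px ?Qy. Qed.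

Section MatrixUnits.

Variables (R : pzRingType) (n : nat) (u : 'I_n -> 'I_n -> R).
Hypothesis uM : forall i j k l, u i j * u k l = if j == k then u i l else 0.

(** The entry of x at position (a, b) with respect to the matrix units u, as an
    element of the centraliser of u: in a matrix ring it is the scalar matrix of
    the entry x_(a, b), see spread_dmx. *)
Definition spread (a b : 'I_n) (x : R) : R := \sum_k u k a * x * u b k.

Lemma spreadM a b c d x y :
  spread a b x * spread c d y = spread a d (x * u b c * y).
Proof.
rewrite mulr_sum_orth => [|i j ij]; last first.
  by rewrite -!mulrA (mulrA (u b i)) uM (negPf ij) !(mul0r, mulr0).
apply: eq_bigr => k _.
by rewrite -!mulrA (mulrA (u b k)) uM eqxx !mulrA.
Qed.

Lemma unit_spread i j a b x : u i j * spread a b x = u i a * x * u b j.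
Proof.
rewrite mulr_sumr (bigD1 j) //= big1 ?addr0 => [|k kj].
  by rewrite !mulrA uM eqxx.
by rewrite !mulrA uM eq_sym (negPf kj) !mul0r.
Qed.

Lemma spread_unit i j a b x : spread a b x * u i j = u i a * x * u b j.
Proof.
rewrite mulr_suml (bigD1 i) //= big1 ?addr0 => [|k ki].
  by rewrite -!mulrA uM eqxx !mulrA.
by rewrite -!mulrA uM (negPf ki) !mulr0.
Qed.

Lemma spread_comm i j a b x : u i j * spread a b x = spread a b x * u i j.
Proof. by rewrite unit_spread spread_unit. Qed.

Lemma mul_spread a b x z : (forall i j, z * u i j = u i j * z) ->
  z * spread a b x = spread a b (z * x).
Proof.
by move=> cz; rewrite mulr_sumr; apply: eq_bigr => k _; rewrite !mulrA cz.
Qed.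

Lemma spread_mul a b x z : (forall i j, z * u i j = u i j * z) ->
  spread a b x * z = spread a b (x * z).
Proof.
move=> cz; rewrite mulr_suml; apply: eq_bigr => k _.
by rewrite -!mulrA -cz.
Qed.

Lemma spread_cutr a b x : spread a b (x * u b b) = spread a b x.
Proof. by apply: eq_bigr => k _; rewrite -!mulrA uM eqxx. Qed.

Lemma spread_cutl a b x : spread a b (u a a * x) = spread a b x.
Proof. by apply: eq_bigr => k _; rewrite mulrA uM eqxx. Qed.

Lemma spread0 a b : spread a b 0 = 0.
Proof. by rewrite /spread big1 // => k _; rewrite mulr0 mul0r. Qed.

Lemma spread_sum a b (J : finType) (S : pred J) (F : J -> R) :
  spread a b (\sum_(j | S j) F j) = \sum_(j | S j) spread a b (F j).
Proof.
rewrite exchange_big /=; apply: eq_bigr => k _.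
by rewrite mulr_sumr mulr_suml.
Qed.

Section Map.

Variables (S : pzRingType) (h : {rmorphism S -> R}).

(** Defined for incomplete systems of units as well, where the unit of R need
    not be hit: the blocks of a product of matrix algebras map to a ring in this
    way, one by one. *)
Definition units_map (A : 'M[S]_n) : R := \sum_i \sum_j u i j * h (A i j).

Lemma units_map0 : units_map 0 = 0.
Proof.
by rewrite /units_map big1 // => i _; rewrite big1 // => j _;
  rewrite mxE rmorph0 mulr0.
Qed.

Lemma units_mapD : {morph units_map : A B / A + B}.
Proof.
move=> A B; rewrite /units_map -big_split; apply: eq_bigr => i _ /=.
rewrite -big_split; apply: eq_bigr => j _ /=.
by rewrite mxE rmorphD mulrDr.
Qed.

Lemma units_map_diag : units_map 1 = \sum_i u i i.
Proof.
apply: eq_bigr => i _; rewrite (bigD1 i) //= big1 ?addr0 => [|j ji].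
  by rewrite mxE eqxx rmorph1 mulr1.
by rewrite mxE eq_sym (negPf ji) rmorph0 mulr0.
Qed.

Lemma units_map_delta i j : units_map (delta_mx i j) = u i j.
Proof.
rewrite /units_map (bigD1 i) //= (bigD1 j) //= !big1 ?addr0 => [|k ki|l lj].
- by rewrite mxE !eqxx rmorph1 mulr1.
- by rewrite big1 // => l _; rewrite mxE (negPf ki) rmorph0 mulr0.
- by rewrite mxE (negPf lj) andbF rmorph0 mulr0.
Qed.

Lemma mul_units_map0 z A : (forall i j, z * u i j = 0) -> z * units_map A = 0.
Proof.
move=> zu; rewrite mulr_sumr big1 // => i _.
by rewrite mulr_sumr big1 // => j _; rewrite mulrA zu mul0r.
Qed.

Lemma units_map_mul0 z A : (forall s, h s * z = z * h s) ->
  (forall i j, u i j * z = 0) -> units_map A * z = 0.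
Proof.
move=> hz uz; rewrite mulr_suml big1 // => i _.
by rewrite mulr_suml big1 // => j _; rewrite -mulrA hz mulrA uz mul0r.
Qed.

Hypothesis hu : forall s i j, h s * u i j = u i j * h s.

Lemma units_mapM : {morph units_map : A B / A * B}.
Proof.
move=> A B; rewrite {2 3}/units_map mulr_suml; apply: eq_bigr => i _.
rewrite exchange_big mulr_sumr; apply: eq_bigr => j _.
rewrite mulr_sum_orth => [|k l kl]; last first.
  by rewrite -mulrA (mulrA (h _)) hu -mulrA mulrA uM (negPf kl) mul0r.
rewrite mxE rmorph_sum mulr_sumr; apply: eq_bigr => k _.
rewrite rmorphM -[RHS]mulrA (mulrA (h _) (u _ _)) hu -(mulrA (u k j)).
by rewrite [RHS]mulrA uM eqxx.
Qed.

Lemma units_map_rmorphism : \sum_i u i i = 1 ->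
  exists H : {rmorphism 'M[S]_n -> R}, H =1 units_map.
Proof.
rewrite -units_map_diag => H1.
pose m1 := GRing.isNmodMorphism.Build _ _ units_map (units_map0, units_mapD).
pose m2 := GRing.isMonoidMorphism.Build _ _ units_map (H1, units_mapM).
by exists (HB.pack units_map m1 m2 : {rmorphism 'M[S]_n -> R}).
Qed.

End Map.

End MatrixUnits.

Section StandardUnits.

Variables (S : pzRingType) (n : nat).

(** The matrix delta_mx, typed so that its products are ring products. *)
Definition dmx (i j : 'I_n) : 'M[S]_n := delta_mx i j.

Lemma dmxM i j k l : dmx i j * dmx k l = if j == k then dmx i l else 0.
Proof.
rewrite -[LHS]/(_ *m _) mul_delta_mx_cond.
by case: (j == k); rewrite ?mulr1n ?mulr0n.
Qed.

Lemma dmx_sum1 : \sum_i dmx i i = 1.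
Proof.
apply/matrixP => i j; rewrite summxE !mxE.
case: eqVneq => [<-|ij].
  rewrite (bigD1 i) //= big1 ?addr0 => [|k ki]; first by rewrite mxE !eqxx.
  by rewrite mxE eq_sym (negPf ki).
rewrite big1 // => k _; rewrite mxE.
by case: eqVneq => // <-; rewrite eq_sym (negPf ij).
Qed.

Lemma dmx_mul i j (A : 'M[S]_n) k l : (dmx i j * A) k l = (k == i)%:R * A j l.
Proof.
rewrite mxE (bigD1 j) //= big1 ?addr0 => [|m mj].
  by rewrite mxE eqxx andbT.
by rewrite mxE (negPf mj) andbF mul0r.
Qed.

Lemma mul_dmx i j (A : 'M[S]_n) k l : (A * dmx i j) k l = A k i * (l == j)%:R.
Proof.
rewrite mxE (bigD1 i) //= big1 ?addr0 => [|m mj].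
  by rewrite mxE eqxx.
by rewrite mxE (negPf mj) mulr0.
Qed.

Lemma scalar_dmx (s : S) i j : s%:M * dmx i j = dmx i j * s%:M.
Proof.
apply/matrixP => k l; rewrite mul_dmx dmx_mul !mxE.
by rewrite (eq_sym l j); case: (k == i); case: (j == l);
  rewrite ?(mulr0, mulr1, mul0r, mul1r, mulr0n).
Qed.

Lemma spread_dmx a b (A : 'M[S]_n) : spread dmx a b A = (A a b)%:M.
Proof.
apply/matrixP => i j; rewrite summxE mxE (bigD1 i) //= big1 ?addr0 => [|k ki].
  by rewrite mul_dmx dmx_mul eqxx mul1r eq_sym mulr_natr.
by rewrite mul_dmx dmx_mul eq_sym (negPf ki) !mul0r.
Qed.

Lemma dmx_scalar_sum (A : 'M[S]_n) : A = \sum_i \sum_j dmx i j * (A i j)%:M.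
Proof.
rewrite [LHS]matrix_sum_delta; apply: eq_bigr => i _; apply: eq_bigr => j _.
by rewrite -scalar_dmx -[RHS]/(_ *m _) mul_scalar_mx.
Qed.

Lemma dmx_scalarM i j k l (s t : S) :
  dmx i j * s%:M * (dmx k l * t%:M) =
  if j == k then dmx i l * (s * t)%:M else 0.
Proof.
rewrite -mulrA (mulrA s%:M) scalar_dmx -mulrA (mulrA (dmx i j)) dmxM.
rewrite -[s%:M * t%:M]/(_ *m _) -scalar_mxM.
by case: ifP; rewrite ?mul0r.
Qed.

End StandardUnits.

(** * The universal property of the Leavitt path algebra *)

Section LeavittRelations.

Variables (K : fieldType) (E : digraph).

Lemma lpa_ghost_edge (e f : edge E) :
  lpa_s K e * lpa_e K f = if e == f then lpa_v K (rng e) else 0.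
Proof. by rewrite [LHS]pres_mulE (lpa_relE (rel_CK1 K e f)); case: ifP. Qed.

Lemma lpa_edge_ghost_sum (v : vertex E) : v \in regular E ->
  \sum_(e in out v) lpa_e K e * lpa_s K e = lpa_v K v.
Proof.
move=> vr; rewrite -[RHS](lpa_relE (rel_CK2 K vr)).
rewrite (big_morph (cls (@lpa_rel K E)) (@clsD _ _ _) (@cls0 _ _ _)).
by apply: eq_bigr => e _; apply: pres_mulE.
Qed.

End LeavittRelations.

Section LeavittUniversal.

Variables (K : fieldType) (E : digraph) (T : kalg K).
Variables (gv : vertex E -> T) (ge gs : edge E -> T).

Hypothesis gvv : forall v w, gv v * gv w = if v == w then gv v else 0.
Hypothesis gse : forall e, gv (src e) * ge e = ge e.
Hypothesis ger : forall e, ge e * gv (rng e) = ge e.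
Hypothesis grs : forall e, gv (rng e) * gs e = gs e.
Hypothesis gss : forall e, gs e * gv (src e) = gs e.
Hypothesis gCK1 : forall e f, gs e * ge f = if e == f then gv (rng e) else 0.
Hypothesis gCK2 : forall v, v \in regular E ->
  \sum_(e in out v) ge e * gs e = gv v.
Hypothesis g1 : \sum_v gv v = 1.

Lemma lpa_universal : exists th : algHom (lpa_alg K E) T,
  [/\ forall v, th (lpa_v K v) = gv v, forall e, th (lpa_e K e) = ge e
    & forall e, th (lpa_s K e) = gs e].
Proof.
pose hh (x : lpa_gen E) : T :=
  match x with GV v => gv v | GE e => ge e | GS e => gs e end.
pose sc (c : K) (x : T) := kin T c * x.
pose th : lpa K E -> T := @pres_eval _ _ (@lpa_rel K E) T *%R sc hh.
have big_teval (I : Type) (r : seq I) (S : pred I)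
    (F : I -> term K (lpa_gen E)) :
    teval *%R sc hh (\big[@TAdd _ _/TZero]_(i <- r | S i) F i)
    = \sum_(i <- r | S i) teval *%R sc hh (F i).
  by apply: (big_morph (teval *%R sc hh)).
have rl t u : lpa_rel t u -> teval *%R sc hh t = teval *%R sc hh u.
  case=> [v w|e|e|e|e|e f|v vr] /=.
  - by rewrite gvv; case: ifP.
  - exact: gse.
  - exact: ger.
  - exact: grs.
  - exact: gss.
  - by rewrite gCK1; case: ifP.
  - by rewrite big_teval; apply: gCK2.
have scA a b x : sc a (sc b x) = sc (a * b) x by rewrite /sc rmorphM mulrA.
have sc1 x : sc 1 x = x by rewrite /sc rmorph1 mul1r.
have scDr c x y : sc c (x + y) = sc c x + sc c y by exact: mulrDr.
have scDl a b x : sc (a + b) x = sc a x + sc b x by rewrite /sc rmorphD mulrDl.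
have scAl c x y : sc c (x * y) = sc c x * y by rewrite /sc mulrA.
have scAr c x y : sc c (x * y) = x * sc c y.
  by rewrite /sc mulrA kin_central mulrA.
have thD x y : th (x + y) = th x + th y.
  exact: (pres_evalD (@mulrA T) (@mulrDl T) (@mulrDr T)).
have thM x y : th (x * y) = th x * th y.
  exact: (pres_evalM (@mulrA T) (@mulrDl T) (@mulrDr T)).
have thZ c x : th (c *: x) = sc c (th x).
  exact: (pres_evalZ (@mulrA T) (@mulrDl T) (@mulrDr T)).
have thg x : th (pres_gen (@lpa_rel K E) x) = hh x.
  exact: (pres_eval_gen (@mulrA T) (@mulrDl T) (@mulrDr T)).
have th0 : th 0 = 0 by apply: (addrI (th 0)); rewrite -thD !addr0.
have th1 : th 1 = 1.
  rewrite -g1 [LHS](big_morph th thD th0).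
  by apply: eq_bigr => v _; apply: (thg (GV v)).
pose m1 := GRing.isNmodMorphism.Build _ _ th (th0, thD).
pose m2 := GRing.isMonoidMorphism.Build _ _ th (th1, thM).
pose thr : {rmorphism lpa K E -> T} := HB.pack th m1 m2.
have thk c : thr (kin (lpa_alg K E) c) = kin T c.
  by rewrite /= /lpa_kin thZ th1 /sc mulr1.
exists (@AlgHom K (lpa_alg K E) T thr thk).
split=> [v|e|e] /=.
- exact: (thg (GV v)).
- exact: (thg (GE e)).
- exact: (thg (GS e)).
Qed.

End LeavittUniversal.

(** * Products of blocks as a free extension of the diagonal *)

Lemma ord2P (s : 'I_2) : (s = 0) + (s = 1).
Proof. by case: s => [[|[|//]] s2]; [left|right]; apply: val_inj. Qed.

Section BlockUniversal.

Variables (K : fieldType) (p q : nat).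
Hypothesis le_pq : (p <= q)%N.

Local Notation N := (p + q).+1.
Local Notation B := (prod_side K p q).
Local Notation base := (base_alg K p q).

(** The base algebra has one coordinate for each of the two diagonal units of
    each 2 x 2 block, followed by one for each of the remaining factors. *)
Definition block_coord (i : 'I_p) (s : 'I_2) : 'I_N := inord (s + i.*2).
Definition last_coord (j : 'I_(q - p).+1) : 'I_N := inord (p.*2 + j).

Definition idem (k : 'I_N) : base := [ffun l => (l == k)%:R].

Definition block_unit (i : 'I_p) (s t : 'I_2) : B :=
  ([ffun i' => if i' == i then delta_mx s t else 0], 0).

Lemma val_block_coord i s : block_coord i s = (s + i.*2)%N :> nat.
Proof. by rewrite inordK //; case: i s => i ip [[|[|]]] //= _; lia. Qed.

Lemma val_last_coord j : last_coord j = (p.*2 + j)%N :> nat.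
Proof. by rewrite inordK //; case: j => j jp /=; lia. Qed.

Lemma block_coord_inj i i' s s' :
  block_coord i s = block_coord i' s' -> i = i' /\ s = s'.
Proof.
move/(congr1 val); rewrite /= !val_block_coord => eq.
have [eqi eqs] : i = i' :> nat /\ s = s' :> nat.
  by case: i i' s s' eq => i ? [i' ?] [s ?] [s' ?] /=; lia.
by split; apply: val_inj.
Qed.

Lemma block_coord_eq i i' s s' :
  (block_coord i s == block_coord i' s') = (i == i') && (s == s').
Proof.
by apply/eqP/andP => [/block_coord_inj[-> ->]|[/eqP-> /eqP->]].
Qed.

Lemma last_coord_inj : injective last_coord.
Proof.
by move=> j j' /(congr1 val); rewrite /= !val_last_coord => /addnI/val_inj.
Qed.

Lemma block_last_coord i s j : block_coord i s != last_coord j.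
Proof.
rewrite -val_eqE /= val_block_coord val_last_coord.
by case: i s j => i ip [s s2] [j ?] /=; lia.
Qed.

Lemma sum_coords (V : nmodType) (F : 'I_N -> V) :
  \sum_k F k = \sum_i \sum_s F (block_coord i s) + \sum_j F (last_coord j).
Proof.
pose G m := F (inord m).
have -> : \sum_k F k = \sum_(0 <= m < p.*2 + (q - p).+1) G m.
  have -> : (p.*2 + (q - p).+1)%N = N by lia.
  by rewrite big_mkord; apply: eq_bigr => k _; rewrite /G inord_val.
(* The first 2 p coordinates are the pairs of the blocks. *)
rewrite (@big_cat_nat _ _ _ p.*2) //=; last exact: leq_addr.
congr (_ + _).
  rewrite -(big_mkord xpredT (fun i => \sum_(s < 2) G (s + i.*2)%N)).
  elim: (p) => [|m IHm]; first by rewrite !big_geq.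
  rewrite doubleS !big_nat_recr //= IHm -addrA; congr (_ + _).
  by rewrite !big_ord_recl big_ord0 addr0.
rewrite -{1}(add0n p.*2) big_addn addKn big_mkord.
by apply: eq_bigr => j _; rewrite /G /last_coord (addnC p.*2).
Qed.

Lemma idemM k l : idem k * idem l = if k == l then idem k else 0.
Proof.
apply/ffunP => m; rewrite !ffunE; case: (eqVneq k l) => [<-|kl]; rewrite !ffunE.
  by case: (m == k); rewrite ?mulr1 ?mulr0.
by case: eqVneq => [->|]; rewrite ?mul0r // (negPf kl) mulr0.
Qed.

Lemma base_sum (r : base) : r = \sum_k idem k * kin base (r k).
Proof.
apply/ffunP => l; rewrite sum_ffunE (bigD1 l) //= big1 ?addr0 => [|k kl].
  by rewrite !ffunE eqxx mul1r.
by rewrite !ffunE eq_sym (negPf kl) mul0r.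
Qed.

Lemma block_unitM i s t t' :
  block_unit i s t * block_unit i t t' = block_unit i s t'.
Proof.
congr (_, _); last by rewrite mulr0.
apply/ffunP => i'; rewrite !ffunE; case: eqP => _; last by rewrite mulr0.
exact: mul_delta_mx.
Qed.

Lemma inverse_pair_block i : inverse_pair (block_unit i 0 0) (block_unit i 1 1)
  (block_unit i 0 1) (block_unit i 1 0).
Proof. by split; apply: block_unitM. Qed.

Lemma idem_inord i s m : (m < N)%N ->
  idem (block_coord i s) (inord m) = (m == s + i.*2)%N%:R.
Proof. by move=> mN; rewrite ffunE -val_eqE /= inordK // val_block_coord. Qed.

Lemma prod_map_idem i s : prod_map (idem (block_coord i s)) = block_unit i s s.
Proof.
congr (_, _); apply/ffunP => j; rewrite [LHS]ffunE [RHS]ffunE; last first.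
  by rewrite ffunE eq_sym (negPf (block_last_coord _ _ _)).
rewrite -[inord j.*2]/(block_coord j 0) -[inord j.*2.+1]/(block_coord j 1).
rewrite !ffunE !block_coord_eq.
by case: (ord2P s) => ->; case: (j == i);
  rewrite /= ?(scale0r, scale1r, addr0, add0r).
Qed.

Section Exists.

Variables (T : kalg K) (f : algHom base T) (x y : 'I_p -> T).
Hypothesis xy_pair : forall i,
  inverse_pair (f (idem (block_coord i 0))) (f (idem (block_coord i 1)))
               (x i) (y i).

(** The candidate image in T of the matrix units of block i. *)
Definition corner (i : 'I_p) (s t : 'I_2) : T :=
  if s == 0 then (if t == 0 then f (idem (block_coord i 0)) else x i)
  else (if t == 0 then y i else f (idem (block_coord i 1))).

Lemma fidemM k l :
  f (idem k) * f (idem l) = if k == l then f (idem k) else 0.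
Proof. by rewrite -rmorphM idemM; case: eqP; rewrite ?rmorph0. Qed.

Lemma corner_diag i s : corner i s s = f (idem (block_coord i s)).
Proof. by case: (ord2P s) => ->. Qed.

Lemma corner_chain i s t t' : corner i s t * corner i t t' = corner i s t'.
Proof.
have [xy yx Px Qy] := xy_pair i; have [xQ yP] := inverse_pairR (xy_pair i).
by case: (ord2P s) (ord2P t) (ord2P t') => -> [] -> [] ->; rewrite /corner /= //
   fidemM eqxx.
Qed.

Lemma cornerL i s t k : k != block_coord i s -> f (idem k) * corner i s t = 0.
Proof.
move=> ks; rewrite -(corner_chain i s s) corner_diag mulrA fidemM (negPf ks).
by rewrite mul0r.
Qed.

Lemma cornerR i s t k : block_coord i t != k -> corner i s t * f (idem k) = 0.
Proof.
move=> tk; rewrite -(corner_chain i s t) corner_diag -mulrA fidemM (negPf tk).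
by rewrite mulr0.
Qed.

(** Each corner absorbs a diagonal idempotent on either side, so orthogonality
    is inherited from those idempotents. *)
Lemma corner_orth i i' s t s' t' : (i != i') || (t != s') ->
  corner i s t * corner i' s' t' = 0.
Proof.
move=> ne; rewrite -(corner_chain i s t) corner_diag -mulrA cornerL ?mulr0 //.
by apply: contraL ne => /eqP/block_coord_inj[-> ->]; rewrite !eqxx.
Qed.

Lemma cornerM i s t t' s' :
  corner i s t * corner i t' s' = if t == t' then corner i s s' else 0.
Proof.
case: eqVneq => [<-|tt']; first exact: corner_chain.
by rewrite corner_orth // tt' orbT.
Qed.

Definition block_map (b : B) : T :=
  \sum_i units_map (corner i) (kin T) (b.1 i)
  + \sum_j f (idem (last_coord j)) * kin T (b.2 j).

Lemma block_map0 : block_map 0 = 0.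
Proof.
rewrite /block_map !big1 ?addr0 // => i _; rewrite ffunE.
  by rewrite rmorph0 mulr0.
exact: units_map0.
Qed.

Lemma block_mapD : {morph block_map : b c / b + c}.
Proof.
move=> b c; rewrite /block_map addrACA -!big_split /=.
by congr (_ + _); apply: eq_bigr => i _; rewrite ffunE ?units_mapD //
  rmorphD mulrDr.
Qed.

Lemma block_mapM : {morph block_map : b c / b * c}.
Proof.
have cT := @kin_central K T.
move=> b c; rewrite /block_map mulrDl !mulrDr.
rewrite [X in _ = _ + X + _]mulr_suml.
rewrite [X in _ = _ + X + _]big1 ?addr0 => [|i _]; last first.
  rewrite mulr_sumr big1 // => j _.
  rewrite mulrA units_map_mul0 ?mul0r // => s t.
  by rewrite cornerR // block_last_coord.
rewrite [X in _ = _ + (X + _)]mulr_suml.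
rewrite [X in _ = _ + (X + _)]big1 ?add0r => [|j _]; last first.
  rewrite mulr_sumr big1 // => i _.
  rewrite -mulrA cT mulrA mul_units_map0 ?mul0r // => s t.
  by rewrite cornerL // eq_sym block_last_coord.
congr (_ + _).
  rewrite mulr_sum_orth => [|i i' ii'].
    apply: eq_bigr => i _; rewrite ffunE.
    by apply: units_mapM => *; [apply: cornerM|apply: cT].
  apply: units_map_mul0 => // s t; apply: mul_units_map0 => s' t'.
  by rewrite corner_orth ?ii'.
rewrite mulr_sum_orth => [|j j' jj'].
  apply: eq_bigr => j _; rewrite ffunE rmorphM -[RHS]mulrA (mulrA _ (f _)).
  by rewrite (cT _ (f _)) !mulrA fidemM eqxx.
rewrite -mulrA (mulrA _ (f _)) (cT _ (f _)) !mulrA fidemM.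
by rewrite (inj_eq last_coord_inj) (negPf jj') !mul0r.
Qed.

Lemma block_map_base (r : base) : block_map (prod_map r) = f r.
Proof.
rewrite [in RHS](base_sum r) rmorph_sum sum_coords; congr (_ + _).
  apply: eq_bigr => i _; rewrite ffunE units_mapD.
  rewrite !big_ord_recl big_ord0 addr0 !rmorphM !algHom_kin.
  congr (_ + _); rewrite /units_map !big_ord_recl !big_ord0 /=.
  - by rewrite !mxE /= !(mulr0, rmorph0, addr0, mulr1).
  - by rewrite !mxE /= !(mulr0, rmorph0, addr0, add0r, mulr1).
by apply: eq_bigr => j _; rewrite ffunE rmorphM algHom_kin.
Qed.

Lemma block_map_unit i s t :
  block_map (block_unit i s t) = corner i s t.
Proof.
rewrite /block_map [X in _ + X]big1 ?addr0 => [|j _]; last first.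
  by rewrite ffunE rmorph0 mulr0.
rewrite (bigD1 i) //= big1 ?addr0 => [|i' ii']; rewrite ffunE.
  by rewrite eqxx units_map_delta.
by rewrite (negPf ii') units_map0.
Qed.

(** The product of the 2 x 2 blocks and of the remaining factors is the algebra
    freely generated over the diagonal by an inverse pair between the two
    diagonal units of each block. *)
Lemma prod_side_universal : exists k : algHom B T,
  [/\ forall r, k (prod_hom K p q r) = f r, forall i, k (block_unit i 0 1) = x i
    & forall i, k (block_unit i 1 0) = y i].
Proof.
have H1 : block_map 1 = 1.
  by rewrite -(rmorph1 (prod_hom K p q)) -(rmorph1 f); apply: block_map_base.
pose m1 := GRing.isNmodMorphism.Build _ _ block_map (block_map0, block_mapD).
pose m2 := GRing.isMonoidMorphism.Build _ _ block_map (H1, block_mapM).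
pose k : {rmorphism B -> T} := HB.pack block_map m1 m2.
have kk c : k (kin B c) = kin T c.
  rewrite -(algHom_kin (prod_hom K p q)) -(algHom_kin f).
  exact: block_map_base.
exists (AlgHom kk); split=> [r|i|i]; first exact: block_map_base.
- exact: block_map_unit.
- exact: block_map_unit.
Qed.

End Exists.

(** An element of the product is its diagonal plus multiples of the
    off-diagonal units, so these data generate. *)
Lemma prod_side_ext (T : pzRingType) (k k' : {rmorphism B -> T}) :
  (forall r, k (prod_hom K p q r) = k' (prod_hom K p q r)) ->
  (forall i, k (block_unit i 0 1) = k' (block_unit i 0 1)) ->
  (forall i, k (block_unit i 1 0) = k' (block_unit i 1 0)) -> k =1 k'.
Proof.
move=> kr k12 k21 b.
pose d : base := [ffun k => \sum_i \sum_s b.1 i s s *+ (k == block_coord i s)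
                           + \sum_j b.2 j *+ (k == last_coord j)].
have dh i s : d (block_coord i s) = b.1 i s s.
  rewrite ffunE [X in _ + X]big1 ?addr0 => [|j _]; last first.
    by rewrite (negPf (block_last_coord _ _ _)).
  rewrite (bigD1 i) //= (bigD1 s) //= eqxx !big1 ?addr0 // => [i' ii'|s' ss'].
    rewrite big1 // => s' _; case: eqP => // /block_coord_inj[ii _].
    by rewrite ii eqxx in ii'.
  by case: eqP => // /block_coord_inj[_ ss]; rewrite ss eqxx in ss'.
have dt j : d (last_coord j) = b.2 j.
  rewrite ffunE big1 ?add0r => [|i _]; last first.
    by rewrite big1 // => s _; rewrite eq_sym (negPf (block_last_coord _ _ _)).
  rewrite (bigD1 j) //= eqxx big1 ?addr0 // => j' jj'.
  by rewrite (inj_eq last_coord_inj) eq_sym (negPf jj').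
clearbody d.
have -> : b = prod_hom K p q d
   + \sum_i (block_unit i 0 1 * kin B (b.1 i 0 1)
             + block_unit i 1 0 * kin B (b.1 i 1 0)).
  set S := \sum_i _.
  have S1 : S.1 = \sum_i (block_unit i 0 1 * kin B (b.1 i 0 1)
                           + block_unit i 1 0 * kin B (b.1 i 1 0)).1.
    exact: (big_morph fst).
  have S2 : S.2 = \sum_i (block_unit i 0 1 * kin B (b.1 i 0 1)
                           + block_unit i 1 0 * kin B (b.1 i 1 0)).2.
    exact: (big_morph snd).
  rewrite [LHS]surjective_pairing [RHS]surjective_pairing; congr (_, _).
    apply/ffunP => i; rewrite ffunE S1 sum_ffunE (bigD1 i) //= big1 ?addr0.
      have d0 : d (inord i.*2) = b.1 i 0 0 by exact: (dh i 0).
      have d1 : d (inord i.*2.+1) = b.1 i 1 1 by exact: (dh i 1).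
      rewrite !ffunE d0 d1 !eqxx; apply/matrixP => s t.
      rewrite !mxE !big_ord_recl !big_ord0 !mxE.
      by case: (ord2P s) (ord2P t) => -> [] ->;
        rewrite /= !(mulr0, mul0r, mulr1, mul1r, addr0, add0r).
    move=> i' ii'; rewrite !ffunE eq_sym (negPf ii').
    by rewrite !mul0r addr0.
  rewrite /= S2 big1 ?addr0 => [|i _].
    by apply/ffunP => j; rewrite !ffunE dt.
  by apply/ffunP => j; rewrite !ffunE !mul0r addr0.
rewrite !rmorphD !rmorph_sum kr; congr (_ + _).
apply: eq_bigr => i _; rewrite !rmorphD !rmorphM k12 k21.
by rewrite -!(algHom_kin (prod_hom K p q)) !kr.
Qed.

End BlockUniversal.

(** * Matrices over the Leavitt path algebra *)

(** Only the following is needed of the numbering of vertices and edges: rv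
    lists the regular vertices, re gives the index of the source of an edge, and
    pv and pe are the diagonal positions at which P_i and the summands of Q_i
    sit. *)

Section MatrixLeavitt.

Variables (K : fieldType) (E : digraph) (n : nat) (I : finType).
Variables (rv : I -> vertex E) (re : edge E -> I).
Variables (pv : I -> 'I_n) (pe : edge E -> 'I_n).
Hypothesis rv_reg : forall i, rv i \in regular E.
Hypothesis re_src : forall e i, (src e == rv i) = (re e == i).
Hypothesis rv_inj : injective rv.
Hypothesis pe_inj : injective pe.

Local Notation D := {ffun vertex E -> K}.
Local Notation KE0 := (pow_alg (vertex E) (self_alg K)).
Local Notation M := (mat_side K E n).
Local Notation L := (lpa K E).
Local Notation ML := (mat_alg n (lpa_alg K E)).
Local Notation d := (@dmx KE0 n).
Local Notation dL := (@dmx (lpa_alg K E) n).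

Definition vert (v : vertex E) : M := (alpha K v)%:M.

(** The idempotents P_i and Q_i. *)
Definition src_idem (i : I) : M := eps K n (pv i) (rv i).
Definition rng_idem (i : I) : M :=
  \sum_(e in out (rv i)) eps K n (pe e) (rng e).

Lemma src_re e : rv (re e) = src e.
Proof. by apply/esym/eqP; rewrite re_src. Qed.

Lemma out_re e : e \in out (rv (re e)).
Proof. by rewrite inE src_re. Qed.

Lemma epsE (a : 'I_n) v : eps K n a v = d a a * vert v.
Proof.
apply/matrixP => i j; rewrite dmx_mul !mxE !val_eqE (eq_sym j).
by case: (i == a); case: (a == j); rewrite ?(mul0r, mul1r, mulr0n).
Qed.

Lemma vertM v w : vert v * vert w = if v == w then vert v else 0.
Proof.
rewrite -[LHS]/(_ *m _) -scalar_mxM alphaM; case: ifP => // _.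
by rewrite raddf0.
Qed.

Lemma sum_alpha : \sum_v alpha K v = 1 :> D.
Proof.
apply/ffunP => v; rewrite sum_ffunE (bigD1 v) //= big1 ?addr0 => [|w wv].
  by rewrite !ffunE eqxx.
by rewrite ffunE eq_sym (negPf wv).
Qed.

Lemma sum_vert : \sum_v vert v = 1.
Proof. by rewrite -raddf_sum sum_alpha. Qed.

Lemma alpha_sum (a : KE0) : a = \sum_v (alpha K v : KE0) * kin KE0 (a v).
Proof.
apply/ffunP => w; rewrite sum_ffunE (bigD1 w) //= big1 ?addr0 => [|v vw].
  by rewrite !ffunE eqxx mul1r.
by rewrite !ffunE eq_sym (negPf vw) mul0r.
Qed.

Lemma scalar_mx_sum (a : KE0) : a%:M = \sum_v vert v * kin M (a v).
Proof.
rewrite [in LHS](alpha_sum a) raddf_sum; apply: eq_bigr => v _.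
exact: scalar_mxM.
Qed.

Definition lpa_diag (a : D) : L := \sum_v a v *: lpa_v K v.

Lemma lpa_diag_nmod : lpa_diag 0 = 0 /\ {morph lpa_diag : a b / a + b}.
Proof.
split=> [|a b].
  by rewrite /lpa_diag big1 // => v _; rewrite ffunE scale0r.
rewrite /lpa_diag -big_split; apply: eq_bigr => v _ /=.
by rewrite ffunE scalerDl.
Qed.

Lemma lpa_diag_monoid : lpa_diag 1 = 1 /\ {morph lpa_diag : a b / a * b}.
Proof.
split=> [|a b].
  by apply: eq_bigr => v _; rewrite ffunE scale1r.
rewrite /lpa_diag mulr_sum_orth => [|v w vw].
  apply: eq_bigr => v _.
  rewrite -lpa_scalerAl -lpa_scalerAr scalerA ffunE; congr (_ *: _).
  by rewrite [RHS]lpa_vv eqxx.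
rewrite -lpa_scalerAl -lpa_scalerAr [X in _ *: (_ *: X)]lpa_vv (negPf vw).
by rewrite !scaler0.
Qed.

HB.instance Definition _ :=
  GRing.isNmodMorphism.Build D L lpa_diag lpa_diag_nmod.
HB.instance Definition _ :=
  GRing.isMonoidMorphism.Build D L lpa_diag lpa_diag_monoid.

Lemma lpa_diag_alpha v : lpa_diag (alpha K v) = lpa_v K v.
Proof.
rewrite /lpa_diag (bigD1 v) //= big1 ?addr0 => [|w wv].
  by rewrite ffunE eqxx scale1r.
by rewrite ffunE (negPf wv) scale0r.
Qed.

Lemma lpa_diag_kin c : lpa_diag (pow_kin _ (self_alg K) c) = lpa_kin E c.
Proof.
rewrite /lpa_kin scaler_sumr; apply: eq_bigr => v _.
by rewrite ffunE.
Qed.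

Lemma map_lpa_diag_kin c : map_mx lpa_diag (kin M c) = kin ML c.
Proof. by rewrite map_scalar_mx /= lpa_diag_kin. Qed.

Definition diag_hom : algHom M ML :=
  @AlgHom K M ML (map_mx lpa_diag) map_lpa_diag_kin.

Definition edge_row (i : I) : ML :=
  \sum_(e in out (rv i)) dL (pv i) (pe e) * (lpa_e K e)%:M.

Definition edge_col (i : I) : ML :=
  \sum_(e in out (rv i)) dL (pe e) (pv i) * (lpa_s K e)%:M.

Lemma diag_hom_dmx a b : diag_hom (d a b) = dL a b.
Proof. by rewrite /= /dmx map_delta_mx. Qed.

Lemma diag_hom_vert v : diag_hom (vert v) = (lpa_v K v)%:M.
Proof. by rewrite /= map_scalar_mx /= lpa_diag_alpha. Qed.

Lemma diag_hom_eps (a : 'I_n) v :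
  diag_hom (eps K n a v) = dL a a * (lpa_v K v)%:M.
Proof. by rewrite epsE rmorphM diag_hom_dmx diag_hom_vert. Qed.

(** The two Cuntz-Krieger relations say exactly that the row of the edges
    leaving a vertex and the column of their ghosts are inverse to each other. *)
Lemma inverse_pair_edges i :
  inverse_pair (diag_hom (src_idem i)) (diag_hom (rng_idem i))
               (edge_row i) (edge_col i).
Proof.
split.
- rewrite mulr_sum_orth => [|e f ef]; last first.
    by rewrite dmx_scalarM (inj_eq pe_inj) (negPf ef).
  rewrite diag_hom_eps -lpa_edge_ghost_sum // raddf_sum mulr_sumr.
  by apply: eq_bigr => e _; rewrite dmx_scalarM eqxx.
- rewrite rmorph_sum mulr_suml; apply: eq_bigr => e ev.
  rewrite mulr_sumr (bigD1 e) //= dmx_scalarM eqxx big1 ?addr0 => [|f /andP[_ fe]].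
    by rewrite lpa_ghost_edge eqxx diag_hom_eps.
  by rewrite dmx_scalarM eqxx lpa_ghost_edge eq_sym (negPf fe) raddf0 mulr0.
- rewrite diag_hom_eps mulr_sumr; apply: eq_bigr => e; rewrite inE => /eqP <-.
  by rewrite dmx_scalarM eqxx [X in X%:M]lpa_se.
- rewrite rmorph_sum mulr_sum_orth => [|e f ef]; last first.
    by rewrite diag_hom_eps dmx_scalarM (inj_eq pe_inj) (negPf ef).
  apply: eq_bigr => e _.
  by rewrite diag_hom_eps dmx_scalarM eqxx [X in X%:M]lpa_rs.
Qed.

(** Each edge, as a scalar matrix, is read off from the row that contains it;
    this is why rows and columns generate together with M. *)
Lemma spread_edge_row e :
  spread dL (pv (re e)) (pe e) (edge_row (re e)) = (lpa_e K e)%:M.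
Proof.
rewrite spread_dmx summxE (bigD1 e) ?out_re //= big1 ?addr0 => [|f /andP[_ fe]].
  by rewrite dmx_mul eqxx mul1r mxE eqxx.
by rewrite dmx_mul eqxx mul1r mxE (inj_eq pe_inj) (negPf fe).
Qed.

Lemma spread_edge_col e :
  spread dL (pe e) (pv (re e)) (edge_col (re e)) = (lpa_s K e)%:M.
Proof.
rewrite spread_dmx summxE (bigD1 e) ?out_re //= big1 ?addr0 => [|f /andP[_ fe]].
  by rewrite dmx_mul eqxx mul1r mxE eqxx.
by rewrite dmx_mul (inj_eq pe_inj) eq_sym (negPf fe) mul0r.
Qed.

Lemma mat_lpa_ext (T : pzRingType) (u w : {rmorphism ML -> T}) :
  (forall m, u (diag_hom m) = w (diag_hom m)) ->
  (forall i, u (edge_row i) = w (edge_row i)) ->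
  (forall i, u (edge_col i) = w (edge_col i)) -> u =1 w.
Proof.
move=> uwh uwx uwy.
have uwd a b : u (dL a b) = w (dL a b).
  by rewrite -!diag_hom_dmx.
have uws a b m : u m = w m -> u (spread dL a b m)
                              = w (spread dL a b m).
  move=> uwm; rewrite !rmorph_sum; apply: eq_bigr => k _.
  by rewrite !rmorphM !uwd uwm.
have uwl (l : L) : u l%:M = w l%:M.
  elim/pres_elim: l => [|[v|e|e]|a b ua ub|c a ua|a b ua ub].
  - by rewrite !raddf0.
  - by rewrite -[pres_gen _ _]/(lpa_v K v) -diag_hom_vert.
  - rewrite -[pres_gen _ _]/(lpa_e K e) -spread_edge_row; exact: uws.
  - rewrite -[pres_gen _ _]/(lpa_s K e) -spread_edge_col; exact: uws.
  - by rewrite !raddfD /= ua ub.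
  - have -> : (c *: a)%:M = kin ML c * a%:M :> ML.
      rewrite -[RHS]/(_ *m _) -scalar_mxM -[lpa_kin _ _ * _]lpa_scalerAl.
      by rewrite mul1r.
    by rewrite !rmorphM ua -(algHom_kin diag_hom) uwh.
  - have -> : (pres_mul a b)%:M = (a%:M : ML) * (b%:M : ML).
      exact: (@scalar_mxM (lpa_alg K E) n a b).
    by rewrite !rmorphM ua ub.
move=> m; rewrite (dmx_scalar_sum m) !rmorph_sum; apply: eq_bigr => a _.
rewrite !rmorph_sum; apply: eq_bigr => b _.
by rewrite !rmorphM uwd uwl.
Qed.

Lemma rng_idem_entry e f :
  rng_idem (re e) (pe e) (pe f) = if e == f then alpha K (rng e) else 0.
Proof.
rewrite summxE (bigD1 e) ?out_re //= big1 ?addr0 => [|g /andP[_ ge]].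
  by rewrite mxE !val_eqE eqxx (inj_eq pe_inj) eq_sym.
by rewrite mxE !val_eqE (inj_eq pe_inj) eq_sym (negPf ge).
Qed.

Section Exists.

Variables (T : kalg K) (io : algHom M T) (x y : I -> T).
Hypothesis xy_pair : forall i,
  inverse_pair (io (src_idem i)) (io (rng_idem i)) (x i) (y i).

Local Notation ep a b := (io (d a b)).
Local Notation ga v := (io (vert v)).

Lemma epM a b a' b' : ep a b * ep a' b' = if b == a' then ep a b' else 0.
Proof. by rewrite -rmorphM dmxM; case: ifP; rewrite ?rmorph0. Qed.

Lemma gaM v w : ga v * ga w = if v == w then ga v else 0.
Proof. by rewrite -rmorphM vertM; case: ifP; rewrite ?rmorph0. Qed.

Lemma ga_ep v a b : ga v * ep a b = ep a b * ga v.
Proof. by rewrite -!rmorphM scalar_dmx. Qed.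

Lemma io_src_idem i : io (src_idem i) = ep (pv i) (pv i) * ga (rv i).
Proof. by rewrite -rmorphM -epsE. Qed.

Lemma io_rng_idem i :
  io (rng_idem i) = \sum_(e in out (rv i)) ep (pe e) (pe e) * ga (rng e).
Proof. by rewrite rmorph_sum; apply: eq_bigr => e _; rewrite -rmorphM -epsE. Qed.

Lemma pair_xy i : x i * y i = io (src_idem i). Proof. by case: (xy_pair i). Qed.
Lemma pair_yx i : y i * x i = io (rng_idem i). Proof. by case: (xy_pair i). Qed.
Lemma pair_Px i : io (src_idem i) * x i = x i. Proof. by case: (xy_pair i). Qed.
Lemma pair_Qy i : io (rng_idem i) * y i = y i. Proof. by case: (xy_pair i). Qed.
Lemma pair_xQ i : x i * io (rng_idem i) = x i.
Proof. by case: (inverse_pairR (xy_pair i)). Qed.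
Lemma pair_yP i : y i * io (src_idem i) = y i.
Proof. by case: (inverse_pairR (xy_pair i)). Qed.

Lemma ga_x i : ga (rv i) * x i = x i.
Proof.
have gP : ga (rv i) * io (src_idem i) = io (src_idem i).
  by rewrite io_src_idem mulrA ga_ep -mulrA gaM eqxx.
by rewrite -[in LHS](pair_Px i) mulrA gP pair_Px.
Qed.

Lemma ep_x i : ep (pv i) (pv i) * x i = x i.
Proof.
have eP : ep (pv i) (pv i) * io (src_idem i) = io (src_idem i).
  by rewrite io_src_idem mulrA epM eqxx.
by rewrite -[in LHS](pair_Px i) mulrA eP pair_Px.
Qed.

Lemma y_ga i : y i * ga (rv i) = y i.
Proof.
have Pg : io (src_idem i) * ga (rv i) = io (src_idem i).
  by rewrite io_src_idem -mulrA gaM eqxx.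
by rewrite -[in LHS](pair_yP i) -mulrA Pg pair_yP.
Qed.

Lemma y_ep i : y i * ep (pv i) (pv i) = y i.
Proof.
have Pe : io (src_idem i) * ep (pv i) (pv i) = io (src_idem i).
  by rewrite io_src_idem -mulrA ga_ep mulrA epM eqxx.
by rewrite -[in LHS](pair_yP i) -mulrA Pe pair_yP.
Qed.

(** The positions of distinct edges differ, so the idempotent Q_i cut at the
    position of e is the range of e at that position. *)
Lemma rng_idem_ep e :
  io (rng_idem (re e)) * ep (pe e) (pe e) = ep (pe e) (pe e) * ga (rng e).
Proof.
rewrite io_rng_idem mulr_suml (bigD1 e) ?out_re //= big1 ?addr0 => [|f /andP[_ fe]].
  by rewrite -mulrA ga_ep mulrA epM eqxx.
by rewrite -mulrA ga_ep mulrA epM (inj_eq pe_inj) (negPf fe) mul0r.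
Qed.

Lemma ep_rng_idem e :
  ep (pe e) (pe e) * io (rng_idem (re e)) = ep (pe e) (pe e) * ga (rng e).
Proof.
rewrite io_rng_idem mulr_sumr (bigD1 e) ?out_re //= big1 ?addr0 => [|f /andP[_ fe]].
  by rewrite mulrA epM eqxx.
by rewrite mulrA epM (inj_eq pe_inj) eq_sym (negPf fe) mul0r.
Qed.

Lemma x_ep_ga e :
  x (re e) * ep (pe e) (pe e) * ga (rng e) = x (re e) * ep (pe e) (pe e).
Proof. by rewrite -{2}(pair_xQ (re e)) -!mulrA rng_idem_ep. Qed.

Lemma ga_ep_y e :
  ga (rng e) * (ep (pe e) (pe e) * y (re e)) = ep (pe e) (pe e) * y (re e).
Proof. by rewrite -{2}(pair_Qy (re e)) !mulrA ep_rng_idem ga_ep. Qed.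

Local Notation sp := (spread (fun a b => ep a b)).

(** The images of an edge and of its ghost: the entries of x_i and y_i that
    they would be if T were a matrix ring over the Leavitt path algebra. *)
Definition im_edge e := sp (pv (re e)) (pe e) (x (re e)).
Definition im_ghost e := sp (pe e) (pv (re e)) (y (re e)).

Lemma sp_io a b m : sp a b (io m) = io (m a b)%:M.
Proof.
rewrite -spread_dmx rmorph_sum; apply: eq_bigr => k _.
by rewrite !rmorphM.
Qed.

Lemma im_edgeE e :
  im_edge e = sp (pv (re e)) (pe e) (x (re e) * ep (pe e) (pe e)).
Proof. by rewrite spread_cutr //; apply: epM. Qed.

Lemma im_ghostE e :
  im_ghost e = sp (pe e) (pv (re e)) (ep (pe e) (pe e) * y (re e)).
Proof. by rewrite spread_cutl //; apply: epM. Qed.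

(** For edges with different sources the product vanishes because the two
    source vertices are orthogonal; otherwise the sum over positions collapses
    to the entry of y x = Q_i. *)
Lemma im_ghost_edge e f :
  im_ghost e * im_edge f = if e == f then ga (rng e) else 0.
Proof.
rewrite /im_ghost /im_edge spreadM; last exact: epM.
have [rf|ref] := eqVneq (re e) (re f); last first.
  have vv : rv (re e) == rv (re f) = false.
    by rewrite (inj_eq rv_inj) (negPf ref).
  rewrite -(y_ga (re e)) -(ga_x (re f)) /=.
  rewrite -!mulrA (mulrA (ga _) (ep _ _)) ga_ep -mulrA (mulrA (ga _) (ga _)).
  rewrite gaM vv mul0r !mulr0 spread0.
  by case: eqP => // ef; rewrite ef eqxx in ref.
rewrite -rf y_ep pair_yx sp_io rng_idem_entry.
by case: ifP => // _; rewrite raddf0 rmorph0.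
Qed.

Lemma re_out e i : e \in out (rv i) -> re e = i.
Proof. by rewrite inE re_src => /eqP. Qed.

Lemma x_sum_ep i : \sum_(e in out (rv i)) x i * ep (pe e) (pe e) = x i.
Proof.
rewrite -mulr_sumr -[in LHS](pair_xQ i) -mulrA io_rng_idem mulr_sum_orth => [|e f ef].
  rewrite -[RHS](pair_xQ i) io_rng_idem; congr (_ * _); apply: eq_bigr => e _.
  by rewrite -mulrA ga_ep mulrA epM eqxx.
by rewrite -mulrA ga_ep mulrA epM (inj_eq pe_inj) (negPf ef) mul0r.
Qed.

Lemma sum_ep_y i : \sum_(e in out (rv i)) ep (pe e) (pe e) * y i = y i.
Proof.
rewrite -mulr_suml -[in LHS](pair_Qy i) mulrA io_rng_idem mulr_sum_orth => [|e f ef].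
  rewrite -[RHS](pair_Qy i) io_rng_idem; congr (_ * _); apply: eq_bigr => e _.
  by rewrite mulrA epM eqxx.
by rewrite mulrA epM (inj_eq pe_inj) (negPf ef) mul0r.
Qed.

(** The sum over the edges leaving a vertex glues the entries back together to
    x y = P_i. *)
Lemma im_edge_ghost_sum v : v \in regular E ->
  \sum_(e in out v) im_edge e * im_ghost e = ga v.
Proof.
rewrite inE card_gt0 => /set0Pn[e0 e0v].
pose i := re e0; have iv : rv i = v.
  by rewrite src_re; move: e0v; rewrite inE => /eqP.
rewrite -iv; transitivity (sp (pv i) (pv i) (x i * y i)).
  rewrite -[in RHS](x_sum_ep i) mulr_suml spread_sum.
  apply: eq_bigr => e /re_out ei.
  by rewrite spreadM ?ei //; apply: epM.
by rewrite pair_xy sp_io /src_idem mxE !eqxx.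
Qed.

(** The images of edges and ghosts satisfy the Leavitt relations and commute
    with the matrix units coming from M, so they define a map on the matrix
    algebra. *)
Lemma mat_lpa_universal : exists F : algHom ML T,
  [/\ forall m, F (diag_hom m) = io m, forall i, F (edge_row i) = x i
    & forall i, F (edge_col i) = y i].
Proof.
have uM := epM.
have gcomm v a b := ga_ep v a b.
have [th [thv the ths]] : exists th : algHom (lpa_alg K E) T,
  [/\ forall v, th (lpa_v K v) = ga v, forall e, th (lpa_e K e) = im_edge e
    & forall e, th (lpa_s K e) = im_ghost e].
  apply: lpa_universal.
  - exact: gaM.
  - by move=> e; rewrite mul_spread // -src_re ga_x.
  - by move=> e; rewrite im_edgeE spread_mul // x_ep_ga.
  - by move=> e; rewrite im_ghostE mul_spread // ga_ep_y.
  - by move=> e; rewrite spread_mul // -src_re y_ga.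
  - exact: im_ghost_edge.
  - exact: im_edge_ghost_sum.
  - by rewrite -rmorph_sum sum_vert rmorph1.
(* The image of the path algebra centralises the matrix units; it is enough to
   see this on generators. *)
have thC l a b : th l * ep a b = ep a b * th l.
  elim/pres_elim: l => [|[v|e|e]|l m tl tm|c l tl|l m tl tm].
  - by rewrite rmorph0 mul0r mulr0.
  - by rewrite [th _]thv.
  - by rewrite [th _]the; apply/esym/spread_comm.
  - by rewrite [th _]ths; apply/esym/spread_comm.
  - by rewrite rmorphD mulrDl mulrDr tl tm.
  - have -> : c *: l = kin (lpa_alg K E) c * l.
      by rewrite -[RHS]lpa_scalerAl mul1r.
    by rewrite rmorphM algHom_kin -mulrA tl !mulrA kin_central.
  - by rewrite [th _]rmorphM -mulrA tm mulrA tl mulrA.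
have u1 : \sum_a ep a a = 1 by rewrite -rmorph_sum dmx_sum1 rmorph1.
have [F FE] := units_map_rmorphism (u := fun a b => ep a b) uM (h := th) thC u1.
have Fd a b : F (dL a b) = ep a b by rewrite FE units_map_delta.
have Fs (l : L) : F l%:M = th l.
  rewrite FE -[RHS]mul1r -u1 mulr_suml; apply: eq_bigr => a _.
  rewrite (bigD1 a) //= big1 ?addr0 => [|b ba]; first by rewrite mxE eqxx.
  by rewrite mxE eq_sym (negPf ba) rmorph0 mulr0.
have Fio m : F (diag_hom m) = io m.
  rewrite FE [in RHS](dmx_scalar_sum m) rmorph_sum; apply: eq_bigr => a _.
  rewrite rmorph_sum; apply: eq_bigr => b _.
  rewrite rmorphM; congr (_ * _).
  rewrite mxE scalar_mx_sum !rmorph_sum; apply: eq_bigr => v _.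
  have -> : m a b v *: lpa_v K v = lpa_v K v * kin (lpa_alg K E) (m a b v).
    by rewrite -[RHS]lpa_scalerAr mulr1.
  by rewrite !rmorphM thv !algHom_kin.
have Fk c : F (kin ML c) = kin T c.
  by rewrite -(algHom_kin diag_hom) Fio algHom_kin.
exists (AlgHom Fk); split=> [m|i|i] /=; first exact: Fio.
- rewrite rmorph_sum -[RHS]x_sum_ep; apply: eq_bigr => e /re_out ei.
  rewrite rmorphM Fd Fs the /im_edge ei unit_spread; last exact: uM.
  by rewrite ep_x.
- rewrite rmorph_sum -[RHS]sum_ep_y; apply: eq_bigr => e /re_out ei.
  rewrite rmorphM Fd Fs ths /im_ghost ei unit_spread; last exact: uM.
  by rewrite -mulrA y_ep.
Qed.

End Exists.

End MatrixLeavitt.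

(** * The given numbering of vertices and edges *)

Section Labelling.

Variables (K : fieldType) (E : digraph) (p q n : nat) (lab : labelling E p q).
Hypothesis reg_p : #|regular E| = p.
Hypothesis vert_q : #|vertex E| = q.

Local Notation m i := #|out (lab_v lab i)|.

Lemma le_regular_vertex : (p <= q)%N.
Proof. by rewrite -reg_p -vert_q max_card. Qed.

Definition reg_index (i : 'I_p) : 'I_q := widen_ord le_regular_vertex i.

Definition reg_vertex (i : 'I_p) : vertex E := lab_v lab (reg_index i).

(** The coordinate maps to P_i or to Q_i, which are the members of the family
    for the values false and true of the flag. *)
Lemma mat_hom_idem i (b : bool) :
  mat_hom K n lab (idem K (block_coord q i (if b then 1 else 0)))
  = Defs.family K n lab (reg_index i, b).
Proof.
have pq := le_regular_vertex.
rewrite [LHS]mat_mapE /comb idem_inord // [X in _ * kin _ X](_ : _ = 0); last first.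
  by case: b; rewrite /= gtn_eqF //; case: i => i /=; lia.
rewrite rmorph0 mulr0 addr0 (bigD1 (reg_index i, b)) //= big1 ?addr0 => [|[j c] jc].
  rewrite idem_inord //; last first.
    by rewrite /slot /=; case: i b => i ip [] /=; case: ifP; lia.
  rewrite [X in nat_of_bool X](_ : _ = true) ?rmorph1 ?mulr1 // /slot /= ltn_ord.
  by case: b; rewrite eqxx.
rewrite idem_inord //; last first.
  by rewrite /slot /=; case: j c {jc} => j jq [] /=; case: ifP; lia.
rewrite [X in nat_of_bool X](_ : _ = false) ?rmorph0 ?mulr0 //; apply: contraNF jc.
rewrite /slot xpair_eqE -val_eqE /=.
by case: i b j c => i ip [] [j jq] [] /=; case: ifP; lia.
Qed.

Hypothesis n_eq : n = (#|vertex E| + #|edge E|)%N.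

Lemma sum_out : (\sum_(i < q) (m i).+1 = n)%N.
Proof.
have -> : (\sum_(i < q) (m i).+1 = q + \sum_(i < q) m i)%N.
  have q1 : q = (\sum_(i < q) 1)%N by rewrite sum1_card card_ord.
  by rewrite [X in (X + _)%N]q1 -big_split.
rewrite n_eq vert_q; congr (_ + _)%N.
rewrite -(reindex (lab_v lab) (P := xpredT) (F := fun v => #|out v|)) /=; last first.
  exact/onW_bij/lab_v_bij.
rewrite -sum1_card (partition_big (@src E) xpredT) //=.
by apply: eq_bigr => v _; rewrite -sum1_card; apply: eq_bigl => e; rewrite inE.
Qed.

(** The consecutive segments of sizes m_i + 1 fill up the n positions, because
    there are q of them and the m_i add up to the number of edges. *)
Lemma mhat_lt_n i c : (c <= m i)%N -> (mhat lab i + c < n)%N.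
Proof.
move=> cm; rewrite -sum_out (bigID (fun l : 'I_q => (l < i)%N)) /= ltn_add2l.
by rewrite (bigD1 i) /= ?ltnn // ltn_addr.
Qed.

Definition vertex_pos (i : 'I_p) : 'I_n :=
  Ordinal (leq_ltn_trans (leq_addr 0 _) (mhat_lt_n (leq0n (m (reg_index i))))).

(** Pairs (i, j) with i regular; they number all the edges, since a vertex that
    emits an edge is regular. *)
Definition out_index := {i : 'I_p & 'I_(m (reg_index i))}.

Definition out_edge (x : out_index) : edge E := lab_f (tagged x).

Definition edge_pos (x : out_index) : 'I_n :=
  Ordinal (mhat_lt_n (ltn_ord (tagged x))).

Lemma reg_vertex_inj : injective reg_vertex.
Proof.
by move=> i j /(bij_inj (lab_v_bij lab))/(congr1 val)/= /val_inj.
Qed.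

Lemma reg_vertex_regular i : reg_vertex i \in regular E.
Proof. by apply: lab_v_reg; apply: (ltn_ord i). Qed.

Lemma src_out_edge x : src (out_edge x) = reg_vertex (tag x).
Proof.
apply/eqP; suff: out_edge x \in out (reg_vertex (tag x)) by rewrite inE.
by apply/lab_f_out; exists (tagged x).
Qed.

Lemma edge_pos_inj : injective edge_pos.
Proof.
move=> [i j] [i' j'] /(congr1 val) /=.
case/(mhat_inj (ltn_ord j) (ltn_ord j')) => /(congr1 val)/= /val_inj ii'.
by case: i' / ii' j' => j' [] /val_inj ->.
Qed.

Lemma out_edge_inj : injective out_edge.
Proof.
move=> [i j] [i' j'] eq; have := src_out_edge (Tagged _ j).
rewrite [out_edge _]eq src_out_edge => /reg_vertex_inj/esym/= ii'.
by case: _ / ii' j' eq => j' /lab_f_inj/= ->.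
Qed.

Lemma out_edge_surj e : exists x, out_edge x = e.
Proof.
have [g _ gK] := lab_v_bij lab.
have ve : lab_v lab (g (src e)) = src e by exact: gK.
have eo : e \in out (lab_v lab (g (src e))) by rewrite inE ve.
have ip : (g (src e) < p)%N.
  rewrite ltnNge; apply/negP => /(lab_v_sink lab); rewrite inE => /eqP out0.
  by rewrite out0 inE in eo.
move: eo; have -> : g (src e) = reg_index (Ordinal ip) by apply: val_inj.
by case/lab_f_out => j <-; exists (existT _ (Ordinal ip) j).
Qed.

Lemma eQ_out_edges (edge_index : edge E -> out_index) i :
  cancel edge_index out_edge ->
  eQ K n lab (reg_index i)
  = \sum_(e in out (reg_vertex i)) eps K n (edge_pos (edge_index e)) (rng e).
Proof.
move=> idxK.
have idx j : edge_index (out_edge (existT _ i j)) = existT _ i j.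
  exact/out_edge_inj/idxK.
have -> : out (reg_vertex i) = [set lab_f j | j : 'I_(m (reg_index i))].
  apply/eqP; rewrite eqEsubset; apply/andP; split; apply/subsetP => e.
    by case/lab_f_out => j <-; apply: imset_f.
  by case/imsetP => j _ ->; apply/lab_f_out; exists j.
rewrite big_imset => [|j j' _ _]; last exact: lab_f_inj.
by apply: eq_bigr => j _ /=; rewrite [edge_index _]idx.
Qed.

End Labelling.

(** * The coproduct as a free extension by inverse pairs *)

Section CoproductUniversal.

Variables (K : fieldType) (p q : nat) (M : kalg K).
Variable f : algHom (base_alg K p q) M.
Hypothesis le_pq : (p <= q)%N.

Local Notation B := (prod_side K p q).
Local Notation C := (coprod_alg f (prod_hom K p q)).
Local Notation bu := (@block_unit K p q).
Local Notation idem i s := (idem K (block_coord q i s)).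

Definition inl_hom : algHom M C :=
  @AlgHom K M C (coprod_inl f (prod_hom K p q))
    (fun c => congr1 (coprod_inl f (prod_hom K p q)) (esym (algHom_kin f c))).

Definition inr_hom : {rmorphism B -> C} := coprod_inr f (prod_hom K p q).

Lemma inr_idem i s : inr_hom (bu i s s) = inl_hom (f (idem i s)).
Proof. by rewrite -prod_map_idem // -[LHS]coprod_amalg. Qed.

(** A map out of the coproduct is a map out of M and a compatible map out of
    the blocks; the latter amounts to inverse pairs between the images in T of
    the diagonal units. *)
Lemma coprod_block_universal (T : kalg K) (io : algHom M T) (x y : 'I_p -> T) :
  (forall i, inverse_pair (io (f (idem i 0))) (io (f (idem i 1))) (x i) (y i)) ->
  exists u : algHom C T, [/\ forall m, u (inl_hom m) = io m,
    forall i, u (inr_hom (bu i 0 1)) = x i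
    & forall i, u (inr_hom (bu i 1 0)) = y i].
Proof.
move=> xy_pair.
have fk c : (io \o f) (kin _ c) = kin T c by rewrite /= !algHom_kin.
have [k [kr kx ky]] :=
  @prod_side_universal K p q le_pq T (@AlgHom K _ T (io \o f) fk) x y xy_pair.
have [[u [ul ur]] _] := @coprod_universal _ _ _ f (prod_hom K p q) T io k
  (fun r => esym (kr r)).
have uk c : u (kin C c) = kin T c by rewrite [LHS]ul -[RHS]fk.
exists (@AlgHom K C T u uk); split=> [a|i|i].
- exact: ul.
- by rewrite -kx; apply: ur.
- by rewrite -ky; apply: ur.
Qed.

Lemma coprod_block_ext (T : pzRingType) (u w : {rmorphism C -> T}) :
  (forall m, u (inl_hom m) = w (inl_hom m)) ->
  (forall i, u (inr_hom (bu i 0 1)) = w (inr_hom (bu i 0 1))) ->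
  (forall i, u (inr_hom (bu i 1 0)) = w (inr_hom (bu i 1 0))) -> u =1 w.
Proof.
move=> uwl uwx uwy; elim/coprod_elim => [|a|b|a b ua ub|a ua|a b ua ub].
- by rewrite !rmorph0.
- exact: uwl.
- apply: (@prod_side_ext K p q le_pq T (u \o inr_hom) (w \o inr_hom)) => //= r.
  by rewrite -!coprod_amalg; apply: uwl.
- by rewrite !rmorphD ua ub.
- by rewrite !rmorphN ua.
- by rewrite !rmorphM ua ub.
Qed.

End CoproductUniversal.

(** * The isomorphism *)

Theorem theorem4p3 (K : fieldType) (E : digraph) (p q n : nat)
    (lab : labelling E p q) :
  #|regular E| = p -> #|vertex E| = q -> n = (#|vertex E| + #|edge E|)%N ->
  alg_isomorphic (mat_alg n (lpa_alg K E))
                 (coprod_alg (mat_hom K n lab) (prod_hom K p q)).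
Proof.
move=> reg_p vert_q n_eq; have pq := le_regular_vertex reg_p vert_q.
(* tg numbers the edges: it inverts the enumeration of the f_(i, j). *)
have [tg tgK] := fin_all_exists (out_edge_surj lab reg_p vert_q).
pose rv := reg_vertex lab reg_p vert_q.
pose re e := tag (tg e); pose pv := vertex_pos lab reg_p vert_q n_eq.
pose pe e := edge_pos n_eq (tg e).
have rv_inj : injective rv by exact: reg_vertex_inj.
have re_src e i : (src e == rv i) = (re e == i).
  by rewrite -[in LHS](tgK e) src_out_edge (inj_eq rv_inj).
have pe_inj : injective pe.
  by move=> e f /edge_pos_inj tef; rewrite -(tgK e) tef tgK.
have fP i : mat_hom K n lab (idem K (block_coord q i 0)) = src_idem K rv pv i.
  exact: (@mat_hom_idem K E p q n lab reg_p vert_q i false).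
have fQ i : mat_hom K n lab (idem K (block_coord q i 1)) = rng_idem K rv pe i.
  rewrite [LHS](@mat_hom_idem K E p q n lab reg_p vert_q i true).
  exact: eQ_out_edges.
have pairL i : inverse_pair
    (diag_hom K E n (mat_hom K n lab (idem K (block_coord q i 0))))
    (diag_hom K E n (mat_hom K n lab (idem K (block_coord q i 1))))
    (edge_row K rv pv pe i) (edge_col K rv pv pe i).
  by rewrite fP fQ; apply: inverse_pair_edges => //; apply: reg_vertex_regular.
have [G [Gl Gx Gy]] := coprod_block_universal pq pairL.
pose inl := inl_hom (mat_hom K n lab).
pose x i := inr_hom (mat_hom K n lab) (block_unit K q i 0 1).
pose y i := inr_hom (mat_hom K n lab) (block_unit K q i 1 0).
have pairC i : inverse_pair (inl (src_idem K rv pv i))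
    (inl (rng_idem K rv pe i)) (x i) (y i).
  by rewrite -fP -fQ -!inr_idem //; apply/inverse_pair_rmorph/inverse_pair_block.
have [F [Fl Fx Fy]] := mat_lpa_universal re_src rv_inj pe_inj pairC.
apply: (@algHom_isomorphic K _ _ F G).
  apply: (mat_lpa_ext (pv := pv) re_src pe_inj (u := G \o F) (w := idfun))
    => [m|i|i] /=.
  - by rewrite Fl Gl.
  - by rewrite Fx Gx.
  - by rewrite Fy Gy.
apply: (coprod_block_ext pq (u := F \o G) (w := idfun)) => [m|i|i] /=.
- by rewrite Gl Fl.
- by rewrite Gx Fx.
- by rewrite Gy Fy.
Qed.
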